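(* Let $n$ be a positive integer, let $a_\bullet=(a_1<\dots<a_k)$ be positive integers with $a_k<n$, and let $\gamma$ be a rational normal curve in $\mathbb{R}^n$. Let $(\sigma_1,\ldots,\sigma_m)$ be a Grassmannian Schubert problem on the flag manifold $\mathbb{F}\ell(a_\bullet;n)$ for which the monotone conjecture holds. Then, for any distinct real numbers $t_1,\ldots,t_m$ that are monotone with respect to $(\sigma_1,\ldots,\sigma_m)$, there exists a number $\epsilon>0$ such that, if for each $i=1,\ldots,m$, $F_\bullet^i$ is a flag secant to $\gamma$ along an interval of length $\epsilon$ containing $t_i$, then the intersection $$X_{\sigma_1}F_\bullet^1\cap X_{\sigma_2}F_\bullet^2\cap\cdots\cap X_{\sigma_m}F_\bullet^m$$ is transverse with all points real.
   Context: **Flag manifolds.** For positive integers $a_\bullet=(a_1<\dots<a_k)$ with $a_k<n$, a flag $E_\bullet$ of type $a_\bullet$ is a chain of linear subspaces $\{0\}\subset E_{a_1}\subset E_{a_2}\subset\dots\subset E_{a_k}\subset\mathbb{C}^n$ with $\dim E_{a_i}=a_i$. The set of these is the flag manifold $\mathbb{F}\ell(a_\bullet;n)$, of dimension $\dim(a_\bullet):=\sum_{i=1}^k(n-a_i)(a_i-a_{i-1})$, where $a_0:=0$. A flag is complete if it has type $1<2<\dots<n-1$; for a complete flag $F_\bullet$ put $F_n=\mathbb{C}^n$. A point $E_\bullet$ of $\mathbb{F}\ell(a_\bullet;n)$ is real if each $E_{a_i}$ is the complexification of a subspace of $\mathbb{R}^n$. **Schubert varieties and problems.** The descent set of $\sigma\in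 S_n$ is $\{i \mid \sigma(i)>\sigma(i+1)\}$, and $\ell(\sigma):=|\{i<j\mid\sigma(i)>\sigma(j)\}|$. A Schubert condition on flags of type $a_\bullet$ is a permutation $\sigma\in S_n$ whose descent set is contained in $\{a_1,\dots,a_k\}$. Given a complete flag $F_\bullet$, the Schubert variety is $$X_\sigma F_\bullet=\{E_\bullet\in\mathbb{F}\ell(a_\bullet;n)\mid \dim (E_{a_i}\cap F_j)\ge \#\{l\le a_i\mid j+\sigma(l)>n\}\ \ \forall i,j\},$$ which is irreducible of codimension $\ell(\sigma)$. A Schubert problem is a list $(\sigma_1,\dots,\sigma_m)$ of Schubert conditions with $\ell(\sigma_1)+\dots+\ell(\sigma_m)=\dim(a_\bullet)$. A permutation is Grassmannian if it has a unique descent, denoted $\delta(\sigma)$; a Grassmannian Schubert problem is one in which all $\sigma_i$ are Grassmannian. **Rational normal curve, secant and osculating flags.** A rational normal curve $\gamma:\mathbb{R}\to\mathbb{R}^n$ is the moment curve $t\mapsto(1,t,t^2,\dots,t^{n-1})$ up to an invertible real linear change of coordinates on $\mathbb{R}^n$. Considered projectively, it is homeomorphic to the circle $\mathbb{RP}^1$. A complete flag $F_\bullet$ is secant to $\gamma$ along an interval $I\subset\mathbb{R}$ if every subspace $F_j$ of the flag is (the complex span of) the span of points of $\gamma(I)$ lying in $F_j$. The osculating flag $F_\bullet(t)$ is the complete flag whose $j$-dimensional subspace $F_j(t)$ is spanned by $\gamma(t),\gamma'(t),\dots,\gamma^{(j-1)}(t)$. **Monotone.** Distinct real numbers $t_1,\dots,t_m$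 (regarded as points of the circle $\mathbb{RP}^1=\mathbb{R}\cup\{\infty\}$) are monotone with respect to a Grassmannian Schubert problem $(\sigma_1,\dots,\sigma_m)$ if, for one of the two orientations of the circle and some starting point on it, reading the $t_i$ in the resulting cyclic order one has $\delta(\sigma_i)<\delta(\sigma_j)\Rightarrow t_i$ comes before $t_j$, for all $i,j$. **The monotone conjecture holds for $(\sigma_1,\dots,\sigma_m)$** means: for all distinct real numbers $t_1,\dots,t_m$ that are monotone with respect to $(\sigma_1,\dots,\sigma_m)$, the intersection $X_{\sigma_1}F_\bullet(t_1)\cap\cdots\cap X_{\sigma_m}F_\bullet(t_m)$ is transverse with all points real. **Transverse.** The intersection (of complementary total codimension) is transverse if it is finite and, at each of its points, every Schubert variety involved is smooth and their tangent spaces meet transversally (only in $0$). *)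

(* Defs.v *)
From HB Require Import structures.
From mathcomp Require Import all_boot all_order all_algebra all_fingroup.
From mathcomp Require mpoly.
From mathcomp Require Import complex.
From mathcomp Require Import all_classical all_reals all_analysis.

Set Implicit Arguments.
Unset Strict Implicit.
Unset Printing Implicit Defensive.

Import Order.TTheory GRing.Theory Num.Theory.
Import numFieldNormedType.Exports.

Local Open Scope ring_scope.
Local Open Scope classical_set_scope.
Local Open Scope complex_scope.

(* Elements of 'I_n are numbered from 0: the value of sigma at the (1-based)
   position p is [(sigma (p - 1)).+1].  Descents are 1-based positions. *)
Definition descents (n : nat) (sigma : 'S_n) : seq nat :=
  [seq d <- iota 1 n.-1 |
    [exists i : 'I_n, exists j : 'I_n,
      [&& i.+1 == d, j == d :> nat & (sigma j < sigma i)%N]]].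

Definition perm_length (n : nat) (sigma : 'S_n) : nat :=
  #|[pred p : 'I_n * 'I_n | (p.1 < p.2)%N && (sigma p.2 < sigma p.1)%N]|.

Definition grassmannian (n : nat) (sigma : 'S_n) : Prop :=
  size (descents sigma) = 1%N.

(* Only meaningful when [grassmannian sigma]. *)
Definition delta (n : nat) (sigma : 'S_n) : nat := head 0%N (descents sigma).

Definition flag_type (n k : nat) (a : k.-tuple nat) : Prop :=
  [/\ (0 < k)%N, sorted ltn a & all (fun d => 0 < d < n)%N a].

(* [nth 0 (0 :: a) i] is the entry of [a] preceding [tnth a i], and 0 for the
   first one. *)
Definition flag_dim (n k : nat) (a : k.-tuple nat) : nat :=
  (\sum_(i < k) (n - tnth a i) * (tnth a i - nth 0 (0 :: a) i))%N.

Definition pflag (R : realType) (n k : nat) : Type :=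
  {ffun 'I_k -> {vspace 'rV[R[i]]_n}}.

Definition flag_manifold (R : realType) (n k : nat) (a : k.-tuple nat) :
    set (pflag R n k) :=
  [set E | (forall i, \dim (E i) = tnth a i) /\
           (forall i j : 'I_k, (i <= j)%N -> (E i <= E j)%VS)].

(* Only the values [F 0, ..., F n] matter; the conditions force [F 0] to be
   zero and [F n] to be the whole space. *)
Definition complete_flag (R : realType) (n : nat)
    (F : nat -> {vspace 'rV[R[i]]_n}) : Prop :=
  (forall j, (j <= n)%N -> \dim (F j) = j) /\
  (forall j l, (j <= l <= n)%N -> (F j <= F l)%VS).

Definition to_complex (R : realType) (n : nat) (v : 'rV[R]_n) : 'rV[R[i]]_n :=
  map_mx (real_complex R) v.

Definition complexification (R : realType) (n : nat) (W : {vspace 'rV[R]_n}) :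
    {vspace 'rV[R[i]]_n} :=
  <<[seq to_complex w | w <- vbasis W]>>%VS.

Definition real_flag (R : realType) (n k : nat) (E : pflag R n k) : Prop :=
  forall i, exists W : {vspace 'rV[R]_n}, E i = complexification W.

Definition schubert_condition (n k : nat) (a : k.-tuple nat) (sigma : 'S_n) :
    Prop :=
  {subset descents sigma <= a}.

Definition schubert_variety (R : realType) (n k : nat) (a : k.-tuple nat)
    (sigma : 'S_n) (F : nat -> {vspace 'rV[R[i]]_n}) : set (pflag R n k) :=
  [set E | flag_manifold a E /\
    forall (i : 'I_k) (j : nat), (1 <= j <= n)%N ->
      (#|[pred l : 'I_n | (l < tnth a i) && (n < j + (sigma l).+1)]|
         <= \dim (E i :&: F j)%VS)%N].

Definition schubert_problem (n k : nat) (a : k.-tuple nat) (m : nat)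
    (sigma : 'I_m -> 'S_n) : Prop :=
  (forall i, schubert_condition a (sigma i)) /\
  (\sum_(i < m) perm_length (sigma i))%N = flag_dim n a.

Definition grassmannian_schubert_problem (n k : nat) (a : k.-tuple nat)
    (m : nat) (sigma : 'I_m -> 'S_n) : Prop :=
  schubert_problem a sigma /\ forall i, grassmannian (sigma i).

(* GL_n(C) acts on the right on row vectors, transitively on the flag manifold
   Fl.  For E in Fl with stabilizer P, the orbit map g |-> E g is a smooth
   surjective morphism GL_n -> Fl with fibre P, and its differential at 1
   identifies T_E Fl with gl_n / p, where p = Lie P is the space of matrices
   preserving every subspace of E.  For X closed in Fl, the Zariski tangent
   space T_E X is therefore T / p, where T is the Zariski tangent space at 1 of
   the inverse image of X in GL_n. *)

Definition flag_act (R : realType) (n k : nat) (E : pflag R n k)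
    (g : 'M[R[i]]_n) : pflag R n k :=
  [ffun i => (linfun (mulmxr g) @: E i)%VS].

Definition stabilizer_algebra (R : realType) (n k : nat) (E : pflag R n k) :
    set 'M[R[i]]_n :=
  [set A | forall i, (linfun (mulmxr A) @: E i <= E i)%VS].

(* Value at [g], and derivative at [g] in the direction [A], of a polynomial
   function of the n * n entries of a matrix. *)
Definition mxpoly_eval (R : realType) (n : nat) (f : mpoly.mpoly (n * n) R[i])
    (g : 'M[R[i]]_n) : R[i] :=
  mpoly.meval (fun u => mxvec g 0 u) f.

Definition mxpoly_diff (R : realType) (n : nat) (f : mpoly.mpoly (n * n) R[i])
    (g A : 'M[R[i]]_n) : R[i] :=
  \sum_u mpoly.meval (fun v => mxvec g 0 v) (mpoly.mderiv u f) * mxvec A 0 u.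

(* The space T above. *)
Definition tangent_lift (R : realType) (n k : nat) (X : set (pflag R n k))
    (E : pflag R n k) : set 'M[R[i]]_n :=
  [set A | forall f : mpoly.mpoly (n * n) R[i],
     (forall g, g \in unitmx -> X (flag_act E g) -> mxpoly_eval f g = 0) ->
     mxpoly_diff f 1%:M A = 0].

(* E is a smooth point of X, where X is irreducible of dimension d: the
   dimension of T_E X = T / p is d. *)
Definition smooth_at (R : realType) (n k : nat) (X : set (pflag R n k))
    (d : nat) (E : pflag R n k) : Prop :=
  exists T P : {vspace 'M[R[i]]_n},
    [/\ forall A, A \in T <-> tangent_lift X E A,
        forall A, A \in P <-> stabilizer_algebra E A &
        \dim T = (\dim P + d)%N].

Definition schubert_intersection (R : realType) (n k : nat) (a : k.-tuple nat)
    (m : nat) (sigma : 'I_m -> 'S_n)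
    (F : 'I_m -> nat -> {vspace 'rV[R[i]]_n}) : set (pflag R n k) :=
  [set E | flag_manifold a E /\
           forall i, schubert_variety a (sigma i) (F i) E].

(* A matrix represents the zero tangent vector at E iff it lies in
   [stabilizer_algebra E]. *)
Definition transverse (R : realType) (n k : nat) (a : k.-tuple nat)
    (m : nat) (sigma : 'I_m -> 'S_n)
    (F : 'I_m -> nat -> {vspace 'rV[R[i]]_n}) : Prop :=
  finite_set (schubert_intersection a sigma F) /\
  forall E, schubert_intersection a sigma F E ->
    (forall i, smooth_at (schubert_variety a (sigma i) (F i))
                 (flag_dim n a - perm_length (sigma i)) E) /\
    (forall A : 'M[R[i]]_n,
       (forall i, tangent_lift (schubert_variety a (sigma i) (F i)) E A) ->
       stabilizer_algebra E A).

Definition transverse_with_all_points_real (R : realType) (n k : nat)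
    (a : k.-tuple nat) (m : nat) (sigma : 'I_m -> 'S_n)
    (F : 'I_m -> nat -> {vspace 'rV[R[i]]_n}) : Prop :=
  transverse a sigma F /\
  forall E, schubert_intersection a sigma F E -> real_flag E.

Definition moment_curve (R : realType) (n : nat) (t : R) : 'rV[R]_n :=
  \row_(j < n) t ^+ j.

Definition rational_normal_curve (R : realType) (n : nat)
    (gamma : R -> 'rV[R]_n) : Prop :=
  exists2 g : 'M[R]_n, g \in unitmx &
    forall t, gamma t = moment_curve n t *m g.

Definition osculating_flag (R : realType) (n : nat) (gamma : R -> 'rV[R]_n)
    (t : R) (j : nat) : {vspace 'rV[R[i]]_n} :=
  <<[seq to_complex (derive1n l gamma t) | l <- iota 0 j]>>%VS.

Definition secant_flag (R : realType) (n : nat) (gamma : R -> 'rV[R]_n)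
    (I : interval R) (F : nat -> {vspace 'rV[R[i]]_n}) : Prop :=
  complete_flag F /\
  forall j, (0 < j < n)%N ->
    exists s : seq R,
      (forall x, x \in s -> x \in I /\ to_complex (gamma x) \in F j) /\
      F j = <<[seq to_complex (gamma x) | x <- s]>>%VS.

(* Bounded interval of length [eps], each endpoint being included or not. *)
Definition interval_of_length (R : realType) (eps : R) (I : interval R) :
    Prop :=
  exists (u : R) (b1 b2 : bool), I = Interval (BSide b1 u) (BSide b2 (u + eps)).

(* [x] strictly precedes [y] when the circle R U {oo} is read in the direction
   of increasing reals, from the starting point [s] (included; [None] is oo):
   from c one meets the reals >= c in increasing order, then oo, then the
   reals < c in increasing order. *)
Definition circle_before (R : realType) (s : option R) (x y : R) : bool :=
  if s is Some c then
    ((c <= x) && (y < c)) || (((c <= x) == (c <= y)) && (x < y))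
  else x < y.

(* The reflection x |-> - x (fixing oo) exchanges the two orientations. *)
Definition oriented_before (R : realType) (reversed : bool) (s : option R)
    (x y : R) : bool :=
  if reversed then circle_before (omap -%R s) (- x) (- y)
  else circle_before s x y.

Definition monotone_points (R : realType) (n m : nat) (sigma : 'I_m -> 'S_n)
    (t : 'I_m -> R) : Prop :=
  exists (reversed : bool) (s : option R), forall i j : 'I_m,
    (delta (sigma i) < delta (sigma j))%N ->
    oriented_before reversed s (t i) (t j).

Definition monotone_conjecture (R : realType) (n k : nat) (a : k.-tuple nat)
    (gamma : R -> 'rV[R]_n) (m : nat) (sigma : 'I_m -> 'S_n) : Prop :=
  forall t : 'I_m -> R, injective t -> monotone_points sigma t ->
    transverse_with_all_points_real a sigma
      (fun i => osculating_flag gamma (t i)).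

(* Main.v *)
(* The theorem is a compactness argument. If it fails, there are, for every l,
   flags secant along intervals of length 1/(l+1) for which the conclusion fails.
   Limits are taken along an ultrafilter on the l's, so that all bounded
   sequences converge and no subsequences are needed. The secant flags are
   F_i h_(i,l)^-1 with F_i osculating and h_(i,l) --> 1 in GL_n: in coordinates
   dual to the Newton polynomials of the points, a secant flag is standard.

   Flags are unitary translates of the standard one, hence points E_l of the
   intersections for the secant flags have limits E, which lie in the osculating
   intersection since rank conditions are closed; write E_l = E p_l, p_l --> 1.
   As the intersection at E is transverse, finitely many polynomials vanishing on
   the Schubert varieties have differentials at E with no common zero, so two
   such sequences with the same limit eventually agree. This gives finiteness
   (the osculating intersection is finite) and reality (E is real, so the complex
   conjugates of the E_l have the same limit), and the tangent spaces at E_l meet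
   only in 0.

   Smoothness at E_l follows because the dimension of the Zariski tangent space
   is upper semicontinuous and is at least the dimension of the Schubert variety
   at each of its points. For a Grassmannian permutation the latter holds since
   every point is a limit, along an explicit line, of points of the open cell,
   where enough tangent vectors can be written down. *)
Require Import Defs.
From mathcomp Require Import all_boot all_order all_algebra all_fingroup.
From mathcomp Require mpoly.
From mathcomp Require Import complex.
From mathcomp Require Import all_classical all_reals all_analysis.
From mathcomp Require Import zify ring lra.

Set Implicit Arguments.
Unset Strict Implicit.
Unset Printing Implicit Defensive.

Import Order.TTheory GRing.Theory Num.Theory.
Import numFieldNormedType.Exports.
Import -(notations) mpoly.

Local Open Scope ring_scope.
Local Open Scope classical_set_scope.
Local Open Scope complex_scope.

(** * Limits along a filter *)

Definition tends (C : numFieldType) (U : set_system nat) (x : nat -> C) (l : C) :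
  Prop := x @ U --> l.

(** Convergence is entrywise, so no norm on matrices enters. The constructor blocks unfolding, and
    the coercion below lets a proof be applied to indices. *)
Variant mtends (C : numFieldType) (U : set_system nat) (p q : nat)
    (M : nat -> 'M[C]_(p, q)) (L : 'M[C]_(p, q)) : Prop :=
  Mtends of forall i j, tends U (fun k => M k i j) (L i j).

Lemma mtends_entry (C : numFieldType) (U : set_system nat) (p q : nat)
    (M : nat -> 'M[C]_(p, q)) (L : 'M[C]_(p, q)) :
  mtends U M L -> forall i j, tends U (fun k => M k i j) (L i j).
Proof. by case. Qed.

Coercion mtends_entry : mtends >-> Funclass.

Section Limits.
Context (C : numFieldType) (U : set_system nat) {UF : ProperFilter U}.

Lemma tends_cst (c : C) : tends U (fun=> c) c.
Proof. exact: cvg_cst. Qed.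

Lemma tendsD x y (a b : C) : tends U x a -> tends U y b ->
  tends U (fun k => x k + y k) (a + b).
Proof. exact: cvgD. Qed.

Lemma tendsN x (a : C) : tends U x a -> tends U (fun k => - x k) (- a).
Proof. exact: cvgN. Qed.

Lemma tendsM x y (a b : C) : tends U x a -> tends U y b ->
  tends U (fun k => x k * y k) (a * b).
Proof. exact: cvgM. Qed.

Lemma tendsV x (a : C) : a != 0 -> tends U x a ->
  tends U (fun k => (x k)^-1) a^-1.
Proof. exact: cvgV. Qed.

Lemma tends_sum (I : Type) (r : seq I) (P : pred I) (x : I -> nat -> C) a :
  (forall i, P i -> tends U (x i) (a i)) ->
  tends U (fun k => \sum_(i <- r | P i) x i k) (\sum_(i <- r | P i) a i).
Proof.
move=> xa; elim: r => [|i r IHr].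
  rewrite big_nil; under eq_fun do rewrite big_nil; exact: tends_cst.
rewrite big_cons; under eq_fun do rewrite big_cons.
by case: ifP => // /xa xai; exact: tendsD.
Qed.

Lemma tends_prod (I : Type) (r : seq I) (P : pred I) (x : I -> nat -> C) a :
  (forall i, P i -> tends U (x i) (a i)) ->
  tends U (fun k => \prod_(i <- r | P i) x i k) (\prod_(i <- r | P i) a i).
Proof.
move=> xa; elim: r => [|i r IHr].
  rewrite big_nil; under eq_fun do rewrite big_nil; exact: tends_cst.
rewrite big_cons; under eq_fun do rewrite big_cons.
by case: ifP => // /xa xai; exact: tendsM.
Qed.

Lemma tends_neq0 x (a : C) : a != 0 -> tends U x a ->
  \forall k \near U, x k != 0.
Proof.
move=> a0 /cvgrPdist_lt /(_ `|a|); rewrite normr_gt0 => /(_ a0).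
apply: filterS => k; apply: contraTN => /eqP ->.
by rewrite subr0 ltxx.
Qed.

Lemma tends_ev x y (a : C) : (\forall k \near U, x k = y k) ->
  tends U x a -> tends U y a.
Proof. by move=> xy; apply: cvg_trans; exact: near_eq_cvg. Qed.

Lemma tends_unique x (a b : C) : tends U x a -> tends U x b -> a = b.
Proof. exact: cvg_unique. Qed.

Lemma mtends_cst p q (L : 'M[C]_(p, q)) : mtends U (fun=> L) L.
Proof. by split=> i j; exact: tends_cst. Qed.

Lemma mtends_ev p q (M N : nat -> 'M[C]_(p, q)) L :
  (\forall k \near U, M k = N k) -> mtends U M L -> mtends U N L.
Proof.
move=> MN ML; split=> i j; apply: tends_ev (ML i j).
by apply: filterS MN => k ->.
Qed.

Lemma mtendsD p q (M N : nat -> 'M[C]_(p, q)) A B :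
  mtends U M A -> mtends U N B -> mtends U (fun k => M k + N k) (A + B).
Proof.
move=> MA NB; split=> i j; rewrite mxE; under eq_fun do rewrite mxE.
exact: tendsD (MA i j) (NB i j).
Qed.

Lemma mtendsM p q r (M : nat -> 'M[C]_(p, q)) (N : nat -> 'M[C]_(q, r)) A B :
  mtends U M A -> mtends U N B -> mtends U (fun k => M k *m N k) (A *m B).
Proof.
move=> MA NB; split=> i j; rewrite mxE; under eq_fun do rewrite mxE.
by apply: tends_sum => l _; exact: tendsM (MA i l) (NB l j).
Qed.

Lemma mtendsZ p q (x : nat -> C) a (M : nat -> 'M[C]_(p, q)) A :
  tends U x a -> mtends U M A -> mtends U (fun k => x k *: M k) (a *: A).
Proof.
move=> xa MA; split=> i j; rewrite mxE; under eq_fun do rewrite mxE.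
exact: tendsM xa (MA i j).
Qed.

Lemma mtends_row_mx p q r (M : nat -> 'M[C]_(p, q)) (N : nat -> 'M[C]_(p, r)) A B :
  mtends U M A -> mtends U N B ->
  mtends U (fun k => row_mx (M k) (N k)) (row_mx A B).
Proof.
move=> MA NB; split=> i j; rewrite mxE; under eq_fun do rewrite mxE.
case: fintype.splitP => l _; [exact: MA | exact: NB].
Qed.

Lemma mtends_mxvec p q (M : nat -> 'M[C]_(p, q)) A :
  mtends U M A -> mtends U (fun k => mxvec (M k)) (mxvec A).
Proof.
move=> MA; split=> i j; case/mxvec_indexP: j => j l; rewrite ord1 mxvecE.
by under eq_fun do rewrite mxvecE; exact: MA.
Qed.

Lemma mtends_vec_mx p q (v : nat -> 'rV[C]_(p * q)) w :
  mtends U v w -> mtends U (fun k => vec_mx (v k)) (vec_mx w : 'M[C]_(p, q)).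
Proof.
by move=> vw; split=> i j; rewrite mxE; under eq_fun do rewrite mxE; exact: vw.
Qed.

Lemma mtends_tr p q (M : nat -> 'M[C]_(p, q)) A :
  mtends U M A -> mtends U (fun k => (M k)^T) A^T.
Proof.
by move=> MA; split=> i j; rewrite mxE; under eq_fun do rewrite mxE; exact: MA.
Qed.

Lemma mtends_det n (M : nat -> 'M[C]_n) A :
  mtends U M A -> tends U (fun k => \det (M k)) (\det A).
Proof.
move=> MA; apply: tends_sum => s _; apply: tendsM; first exact: tends_cst.
by apply: tends_prod => i _; exact: MA.
Qed.

Lemma mtends_unitmx n (M : nat -> 'M[C]_n) A : mtends U M A ->
  A \in unitmx -> \forall k \near U, M k \in unitmx.
Proof.
move=> /mtends_det MA; rewrite unitmxE unitfE => /tends_neq0 /(_ MA).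
by apply: filterS => k; rewrite unitmxE unitfE.
Qed.

Lemma mtends_adj n (M : nat -> 'M[C]_n) A :
  mtends U M A -> mtends U (fun k => \adj (M k)) (\adj A).
Proof.
move=> MA; split=> i j; rewrite mxE; under eq_fun do rewrite mxE.
apply: tendsM; first exact: tends_cst.
apply: mtends_det; split=> r s; rewrite !mxE; under eq_fun do rewrite !mxE.
exact: MA.
Qed.

Lemma mtendsV n (M : nat -> 'M[C]_n) A : mtends U M A ->
  A \in unitmx -> mtends U (fun k => invmx (M k)) (invmx A).
Proof.
move=> MA Au; have Mu := mtends_unitmx MA Au.
apply: (@mtends_ev _ _ (fun k => (\det (M k))^-1 *: \adj (M k))).
  by apply: filterS Mu => k Mu; rewrite /invmx Mu.
rewrite /invmx Au; apply: mtendsZ; last exact: mtends_adj.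
by apply: tendsV; [rewrite -unitfE -unitmxE | exact: mtends_det].
Qed.

(** Lower semicontinuity of the rank: [P] and [Q] reduce [A] to the identity of size [\rank A], and
    [P *m M k *m Q] is eventually invertible. *)
Lemma mtends_rank p q (M : nat -> 'M[C]_(p, q)) A : mtends U M A ->
  \forall k \near U, (\rank A <= \rank (M k))%N.
Proof.
move=> MA; set r := \rank A.
pose P : 'M[C]_(r, p) := pid_mx r *m invmx (col_ebase A).
pose Q : 'M[C]_(q, r) := invmx (row_ebase A) *m pid_mx r.
have PAQ : P *m A *m Q = 1%:M.
  rewrite -[A in _ *m A *m _]mulmx_ebase /P /Q !mulmxA mulmxKV ?col_ebase_unit//.
  rewrite mulmxK ?row_ebase_unit// !mul_pid_mx.
  have [rp rq] : (r <= p)%N /\ (r <= q)%N by rewrite rank_leq_row rank_leq_col.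
  rewrite !(minnn, minn_idPr rp, minn_idPr rq).
  exact: pid_mx_1.
have : mtends U (fun k => P *m M k *m Q) 1%:M.
  by rewrite -PAQ; do 2!apply: mtendsM => //; exact: mtends_cst.
move/mtends_unitmx => /(_ (unitmx1 _ _)); apply: filterS => k.
rewrite -row_full_unit => /eqP <-.
by apply: leq_trans (mxrankM_maxl _ _) (mxrankM_maxr _ _).
Qed.

Lemma mtends_row_free p q (M : nat -> 'M[C]_(p, q)) A : mtends U M A ->
  row_free A -> \forall k \near U, row_free (M k).
Proof.
move=> /mtends_rank MA /eqP Af; apply: filterS MA => k.
by rewrite Af /row_free => pM; rewrite eqn_leq rank_leq_row.
Qed.

End Limits.

Arguments tends_cst {C U UF} c.


(** * Ultrafilter limits of complex sequences *)

Section ComplexLimits.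
Context (R : realType) (U : set_system nat) {UF : ProperFilter U}.

Lemma tends_real_complex (x : nat -> R) l : tends U x l ->
  tends U (fun k => (x k)%:C) l%:C.
Proof.
move=> /cvgrPdist_lt xl; apply/cvgrPdist_lt => e e0.
have [d de] : exists d : R, e = d%:C by apply/complex_realP/gtr0_real.
have {e0} d0 : 0 < d by rewrite -ltcR -de.
apply: filterS (xl _ d0) => k; rewrite de -rmorphB /= normc_def /= expr0n addr0 sqrtr_sqr.
by rewrite ltcR.
Qed.

Lemma tends_conjc (x : nat -> R[i]) l : tends U x l ->
  tends U (fun k => (x k)^*%C) l^*%C.
Proof.
move=> /cvgrPdist_lt xl; apply/cvgrPdist_lt => e e0.
apply: filterS (xl _ e0) => k; rewrite -rmorphB /=.
by case: (l - x k) => u v; rewrite !normc_def /= sqrrN.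
Qed.

Lemma mtends_conjc p q (M : nat -> 'M[R[i]]_(p, q)) A : mtends U M A ->
  mtends U (fun k => map_mx conjc (M k)) (map_mx conjc A).
Proof.
by move=> MA; split=> i j; rewrite mxE; under eq_fun do rewrite mxE; exact: tends_conjc (MA i j).
Qed.

Lemma mtends_real_complex p q (M : nat -> 'M[R]_(p, q)) A : mtends U M A ->
  mtends U (fun k => map_mx (real_complex R) (M k)) (map_mx (real_complex R) A).
Proof.
move=> MA; split=> i j; rewrite mxE; under eq_fun do rewrite mxE.
exact: tends_real_complex (MA i j).
Qed.

End ComplexLimits.

Section UltraLimits.
Context (R : realType) (U : set_system nat) {UU : UltraFilter U}.

(** The image of an ultrafilter under [x] is an ultrafilter containing the compact segment from -1
    to 1, hence it converges. *)
Lemma real_ultra_limit (x : nat -> R) : (forall k, `|x k| <= 1) ->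
  exists l, tends U x l.
Proof.
move=> x1.
have xU : UltraFilter (x @ U).
  split; first exact: fmap_proper_filter.
  move=> G GF xG; apply/seteqP; split=> // A GA.
  case: (in_ultra_setVsetC (x @^-1` A) UU) => // xAc.
  have /xG GAc : (x @ U) (~` A) by [].
  by have [z []] := filter_ex (filterI GA GAc).
have := @segment_compact R (-1) 1; rewrite compact_ultra => /(_ _ xU).
case=> [|l [_ xl]]; last by exists l.
apply: (@filterE _ U) => k /=; by have := x1 k; rewrite ler_norml in_itv.
Qed.

Lemma Re_le_norm (z : R[i]) : `|complex.Re z|%:C <= `|z|.
Proof.
by rewrite normc_def lecR -sqrtr_sqr ler_wsqrtr// lerDl sqr_ge0.
Qed.

Lemma Im_le_norm (z : R[i]) : `|complex.Im z|%:C <= `|z|.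
Proof.
by rewrite normc_def lecR -sqrtr_sqr ler_wsqrtr// lerDr sqr_ge0.
Qed.

Lemma complex_ultra_limit (x : nat -> R[i]) : (forall k, `|x k| <= 1) ->
  exists l, tends U x l.
Proof.
move=> x1.
have [k|a xa] := @real_ultra_limit (fun k => complex.Re (x k)).
  by rewrite -lecR; apply: le_trans (Re_le_norm _) (x1 k).
have [k|b xb] := @real_ultra_limit (fun k => complex.Im (x k)).
  by rewrite -lecR; apply: le_trans (Im_le_norm _) (x1 k).
exists (a%:C + 'i * b%:C).
under [x]funext => k do rewrite [x k]complexE.
apply: tendsD; first exact: tends_real_complex.
by apply: tendsM; [exact: tends_cst | exact: tends_real_complex].
Qed.

Lemma unitarymx_entry_le1 n (M : 'M[R[i]]_n) i j :
  M \is unitarymx -> `|M i j| <= 1.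
Proof.
move=> /unitarymxP /matrixP /(_ i i); rewrite !mxE eqxx => Mi.
rewrite -(@expr_le1 _ 2)// -[leRHS]Mi (bigD1 j)//= !mxE normCK lerDl.
by apply: sumr_ge0 => l _; rewrite !mxE mul_conjC_ge0.
Qed.

(** Compactness of the unitary group: the entries are bounded by 1, and the unitarity relation
    passes to the limit, which is therefore invertible. *)
Lemma unitarymx_ultra_limit n (M : nat -> 'M[R[i]]_n) :
  (forall k, M k \is unitarymx) ->
  exists2 A, A \in unitmx & mtends U M A.
Proof.
move=> Mu.
have lim i j : {l | tends U (fun k => M k i j) l}.
  by apply/cid/complex_ultra_limit => k; exact: unitarymx_entry_le1.
pose A := \matrix_(i, j) projT1 (lim i j).
have MA : mtends U M A by split=> i j; rewrite mxE; exact: projT2 (lim i j).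
exists A => //.
suff : A *m (map_mx conjc A)^T = 1%:M by case/mulmx1_unit.
have MM : mtends U (fun k => M k *m (map_mx conjc (M k))^T) (A *m (map_mx conjc A)^T).
  by have H := mtendsM MA (mtends_tr (mtends_conjc MA)); exact: H.
apply/matrixP => i j; apply: tends_unique (MM i j) _.
apply: (@tends_ev _ _ _ (fun=> 1%:M i j)); last exact: tends_cst.
by apply: nearW => k; rewrite map_trmx (unitarymxP (Mu k)).
Qed.

End UltraLimits.


(** * Polynomial functions *)


Lemma mnm_subm N (m : multinom N) : mnm_sub m m = mnm0.
Proof. by apply/mnmP => i; rewrite mnmBE mnm0E subnn. Qed.

Lemma mpoly_ring_ind (K : comNzRingType) N (P : mpoly N K -> Prop) :
  (forall c, P (mpolyC N c)) -> (forall u : 'I_N, P (mpolyX K (mnm1 u))) ->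
  (forall f g, P f -> P g -> P (f + g)) -> (forall f g, P f -> P g -> P (f * g)) ->
  forall f, P f.
Proof.
move=> PC PX PD PM f; rewrite [f]mpolyE.
have P1 : P 1 by exact: PC.
elim/big_ind: _ => [||m _]; [exact: (PC 0) | exact: PD |].
rewrite -mul_mpolyC; apply: (PM) => //; rewrite mpolyXE_id.
apply: big_ind => // u _; elim: (m u) => // d IHd.
by rewrite exprS; exact: PM.
Qed.

Definition gradient (K : comNzRingType) N (f : mpoly N K) (v : 'rV[K]_N) : 'cV[K]_N :=
  \col_u meval (v 0) (mderiv u f).

Section Gradient.
Context (K : comNzRingType).

Lemma gradientC N c (v : 'rV[K]_N) : gradient (mpolyC N c) v = 0.
Proof. by apply/colP => u; rewrite !mxE mderivC meval0. Qed.

Lemma gradientX N u (v : 'rV[K]_N) : gradient (mpolyX K (mnm1 u)) v = delta_mx u 0.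
Proof.
apply/colP => w; rewrite !mxE mderivX mevalZ mnm1E eqxx andbT [w == u]eq_sym.
case: eqP => [->|_]; last by rewrite mul0r.
by rewrite mnm_subm mpolyX0 meval1 mul1r.
Qed.

Lemma gradientD N (f g : mpoly N K) (v : 'rV[K]_N) : gradient (f + g) v = gradient f v + gradient g v.
Proof. by apply/colP => u; rewrite !mxE mderivD mevalD. Qed.

Lemma gradientM N (f g : mpoly N K) (v : 'rV[K]_N) : gradient (f * g) v =
  meval (v 0) g *: gradient f v + meval (v 0) f *: gradient g v.
Proof.
by apply/colP => u; rewrite !mxE mderivM mevalD !mevalM mulrC.
Qed.

(** The chain rule for a linear substitution; it serves to transport equations from one group
    element to a translated one. *)
Lemma linear_substitution N N' (L : 'M[K]_(N', N)) (f : mpoly N K) : exists f' : mpoly N' K,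
  forall v : 'rV[K]_N', meval (v 0) f' = meval ((v *m L) 0) f /\
            gradient f' v = L *m gradient f (v *m L).
Proof.
elim/mpoly_ring_ind: f => [c|u|f g [f' ff'] [g' gg']|f g [f' ff'] [g' gg']].
- by exists (mpolyC N' c) => v; rewrite !mevalC !gradientC mulmx0.
- exists (\sum_w mpolyC N' (L w u) * mpolyX K (mnm1 w)) => v; split.
    rewrite raddf_sum mevalXU mxE; apply: eq_bigr => w _.
    by rewrite /= mevalM mevalC mevalXU mulrC.
  rewrite gradientX -colE; apply/colP => r; rewrite !mxE.
  rewrite (raddf_sum (mderiv r)) (raddf_sum (meval (v 0))) (bigD1 r)//= big1 ?addr0 => [|w wr].
    rewrite mderiv_mulC mevalM mevalC mderivX mnm1E eqxx scale1r mnm_subm mpolyX0.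
    by rewrite meval1 mulr1.
  by rewrite mderiv_mulC mevalM mderivX mnm1E (negPf wr) scale0r meval0 mulr0.
- exists (f' + g') => v; have [[fv dfv] [gv dgv]] := (ff' v, gg' v).
  by rewrite !mevalD !gradientD fv gv dfv dgv mulmxDr.
- exists (f' * g') => v; have [[fv dfv] [gv dgv]] := (ff' v, gg' v).
  by rewrite !mevalM !gradientM fv gv dfv dgv mulmxDr !scalemxAr.
Qed.

End Gradient.

Section PolynomialLimits.
Context (K : numFieldType) (U : set_system nat) {UF : ProperFilter U} (N : nat).

Lemma tends_meval (f : mpoly N K) (x : nat -> 'rV[K]_N) z : mtends U x z ->
  tends U (fun k => meval (x k 0) f) (meval (z 0) f).
Proof.
move=> xz; elim/mpoly_ring_ind: f => [c|u|f g ff gg|f g ff gg].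
- by rewrite mevalC; under eq_fun do rewrite mevalC; exact: tends_cst.
- by rewrite mevalXU; under eq_fun do rewrite mevalXU; exact: xz.
- by rewrite mevalD; under eq_fun do rewrite mevalD; exact: tendsD.
- by rewrite mevalM; under eq_fun do rewrite mevalM; exact: tendsM.
Qed.

Lemma mtends_gradient (f : mpoly N K) (x : nat -> 'rV[K]_N) z : mtends U x z ->
  mtends U (fun k => gradient f (x k)) (gradient f z).
Proof.
move=> xz; split=> i j; rewrite mxE; under eq_fun do rewrite mxE.
exact: tends_meval.
Qed.

(** Hadamard's lemma in sequential form: the columns [G k] are difference quotients that make sense
    even when [x k] and [y k] coincide. *)
Lemma mpoly_difference_quotient (f : mpoly N K) (x y : nat -> 'rV[K]_N) z :
  mtends U x z -> mtends U y z -> exists2 G : nat -> 'cV[K]_N,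
    mtends U G (gradient f z) &
    forall k, meval (x k 0) f - meval (y k 0) f = ((x k - y k) *m G k) 0 0.
Proof.
move=> xz yz; elim/mpoly_ring_ind: f => [c|u|f g [F Ff Fxy] [G Gg Gxy]|f g [F Ff Fxy] [G Gg Gxy]].
- exists (fun=> 0) => [|k]; last by rewrite !mevalC subrr mulmx0 mxE.
  by rewrite gradientC; exact: mtends_cst.
- exists (fun=> delta_mx u 0) => [|k].
    by rewrite gradientX; exact: mtends_cst.
  by rewrite !mevalXU -colE !mxE.
- exists (fun k => F k + G k) => [|k]; first by rewrite gradientD; exact: mtendsD.
  by rewrite !mevalD mulmxDr mxE -Fxy -Gxy opprD addrACA.
- exists (fun k => meval (y k 0) g *: F k + meval (x k 0) f *: G k) => [|k].
    by rewrite gradientM; apply: mtendsD; apply: mtendsZ => //; exact: tends_meval.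
  rewrite !mevalM mulmxDr mxE -!scalemxAr !mxE.
  move: (Fxy k) (Gxy k); rewrite !mxE => <- <-.
  ring.
Qed.

End PolynomialLimits.


(** * Subspaces of row vectors *)

Section RowSpaces.
Context (K : fieldType).

Definition vact n (V : {vspace 'rV[K]_n}) (g : 'M[K]_n) : {vspace 'rV[K]_n} :=
  (linfun (mulmxr g) @: V)%VS.

Lemma memv_vact n (V : {vspace 'rV[K]_n}) g v : v \in V -> v *m g \in vact V g.
Proof. by move=> vV; have := memv_img (linfun (mulmxr g)) vV; rewrite lfunE. Qed.

Lemma vactP n (V : {vspace 'rV[K]_n}) g w :
  reflect (exists2 v, v \in V & w = v *m g) (w \in vact V g).
Proof.
apply: (iffP memv_imgP) => -[v vV ->]; exists v => //; first by rewrite lfunE.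
by rewrite lfunE.
Qed.

Lemma mem_vact n (V : {vspace 'rV[K]_n}) g w : g \in unitmx ->
  (w \in vact V g) = (w *m invmx g \in V).
Proof.
move=> gu; apply/vactP/idP => [[v vV ->]|wV]; first by rewrite mulmxK.
by exists (w *m invmx g) => //; rewrite mulmxKV.
Qed.

Lemma vactM n (V : {vspace 'rV[K]_n}) g h : vact V (g *m h) = vact (vact V g) h.
Proof.
apply/vspaceP => w; apply/vactP/vactP => [[v vV ->]|[_ /vactP[v vV ->] ->]].
  by exists (v *m g); [exact: memv_vact | rewrite mulmxA].
by exists v => //; rewrite mulmxA.
Qed.

Lemma vact1 n (V : {vspace 'rV[K]_n}) : vact V 1%:M = V.
Proof. by apply/vspaceP => w; rewrite mem_vact ?unitmx1// invmx1 mulmx1. Qed.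

Lemma vactS n (V W : {vspace 'rV[K]_n}) g : (V <= W)%VS -> (vact V g <= vact W g)%VS.
Proof. exact: limgS. Qed.

Lemma dim_vact n (V : {vspace 'rV[K]_n}) g : g \in unitmx -> \dim (vact V g) = \dim V.
Proof.
move=> gu; apply: limg_dim_eq; apply/eqP; rewrite -subv0; apply/subvP => v.
rewrite memv_cap memv_ker lfunE /= => /andP[_ /eqP vg0].
by rewrite -[v](mulmxK gu) vg0 mul0mx mem0v.
Qed.

Lemma vact_cap n (V W : {vspace 'rV[K]_n}) g : g \in unitmx ->
  vact (V :&: W) g = (vact V g :&: vact W g)%VS.
Proof.
by move=> gu; apply/vspaceP => w; rewrite memv_cap !mem_vact// memv_cap.
Qed.

(** The rows of [Q] are a basis of [V]. On [V], right multiplication by [S] gives the coordinates in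
    this basis, and [S *m Q] is a projector onto [V], so membership in [V] becomes a matrix
    equation. *)
Lemma vspace_coordinates N d (V : {vspace 'rV[K]_N}) : \dim V = d ->
  exists (Q : 'M[K]_(d, N)) (S : 'M[K]_(N, d)),
    Q *m S = 1%:M /\ forall v, (v \in V) = (v *m S *m Q == v).
Proof.
move=> <-.
pose Q := \matrix_(i < \dim V) (vbasis V)`_i.
have zQ (z : 'rV_(\dim V)) : z *m Q = \sum_i z 0 i *: (vbasis V)`_i.
  by rewrite mulmx_sum_row; apply: eq_bigr => i _; rewrite rowK.
have /row_freeP[S QS] : row_free Q.
  apply: inj_row_free => z; rewrite zQ => /freeP z0.
  by apply/rowP => i; rewrite mxE z0 // (basis_free (vbasisP V)).
exists Q, S; split=> // v; apply/idP/eqP => [vV|<-].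
  suff [z ->] : exists z, v = z *m Q by rewrite -(mulmxA z) QS mulmx1.
  exists (\row_i coord (vbasis V) i v); rewrite zQ {1}(coord_vbasis vV).
  by apply: eq_bigr => i _; rewrite mxE.
rewrite zQ; apply: memv_suml => i _; apply: memvZ; apply: vbasis_mem.
by rewrite mem_nth // size_tuple.
Qed.

Lemma mxspace_coordinates n (V : {vspace 'M[K]_n}) :
  exists (Q : 'M[K]_(\dim V, n * n)) (S : 'M[K]_(n * n, \dim V)),
    Q *m S = 1%:M /\ forall A, (A \in V) = (mxvec A *m S *m Q == mxvec A).
Proof.
pose L : 'Hom('M[K]_n, 'rV[K]_(n * n)) := linfun mxvec.
have dL : \dim (L @: V) = \dim V.
  apply: limg_dim_eq; apply/eqP; rewrite -subv0; apply/subvP => v.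
  rewrite memv_cap memv_ker lfunE /= => /andP[_ /eqP v0].
  by rewrite -[v]mxvecK v0 linear0 mem0v.
have [Q [S [QS memL]]] := vspace_coordinates dL; exists Q, S; split=> // A.
rewrite -memL; apply/idP/memv_imgP => [AV|[B BV]]; first by exists A => //; rewrite lfunE.
by rewrite lfunE => /(can_inj mxvecK) ->.
Qed.

(** A subspace of maximal dimension among those contained in [S] is all of [S]: adjoining a missing
    vector of [S] would enlarge it. *)
Lemma ex_vspace (vT : vectType K) (S : set vT) : S 0 ->
  (forall c u v, S u -> S v -> S (c *: u + v)) ->
  exists W : {vspace vT}, forall v, v \in W <-> S v.
Proof.
move=> S0 Slin.
pose P d := `[< exists2 W : {vspace vT}, \dim W = d & forall v, v \in W -> S v >].
have P0 : exists d, P d.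
  by exists 0%N; apply/asboolP; exists 0%VS; [rewrite dimv0 | move=> v; rewrite memv0 => /eqP ->].
have Pmax d : P d -> (d <= \dim {: vT})%N.
  by move=> /asboolP[W <- _]; rewrite dimvS ?subvf.
have [d /asboolP[W Wd WS] dmax] := ex_maxnP P0 Pmax.
exists W => v; split=> [/WS//|Sv]; apply: contrapT => vW.
have /dmax : P (\dim (<[v]> + W)).
  apply/asboolP; exists (<[v]> + W)%VS => // u /memv_addP[_ /vlineP[c ->] [w wW ->]].
  exact: Slin (WS _ wW).
rewrite -Wd => dW; have /eqP WE : W == (<[v]> + W)%VS by rewrite eqEdim addvSr.
by apply: vW; rewrite WE; apply: subvP (addvSl _ _) _ (memv_line v).
Qed.

(** Each step of the chain is reached from the previous one by adjoining a basis of a complement. *)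
Lemma chain_basis (vT : vectType K) (s : seq {vspace vT}) :
  pairwise (fun U V => (U <= V)%VS) s ->
  exists X : seq vT, basis_of fullv X /\
    forall V, V \in s -> V = <<take (\dim V) X>>%VS.
Proof.
move=> spw.
(* The full space is appended to the chain so that the family ends as a basis of the whole space. *)
suff: exists X, [/\ free X, <<X>>%VS = last 0%VS (rcons s fullv) &
    forall V, V \in rcons s fullv -> V = <<take (\dim V) X>>%VS].
  rewrite last_rcons => -[X [Xf XE XV]]; exists X; split.
    by rewrite /basis_of XE eqxx Xf.
  by move=> V Vs; apply: XV; rewrite mem_rcons inE Vs orbT.
have {spw} : pairwise (fun U V => (U <= V)%VS) (rcons s fullv).
  by rewrite pairwise_rcons spw andbT; apply/allP => V _; exact: subvf.
elim/last_ind: {s}(rcons s fullv) => [_|s V IHs].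
  by exists [::]; rewrite nil_free span_nil.
rewrite pairwise_rcons => /andP[/allP sV /IHs[X [Xf XE XV]]].
have XVs : (<<X>> <= V)%VS.
  by rewrite XE; case: (lastP s) sV => [|s' W] sV; rewrite ?sub0v// last_rcons sV// mem_rcons mem_head.
pose Y := vbasis (V :\: <<X>>).
have spXY : <<X ++ Y>>%VS = V.
  rewrite span_cat (span_basis (vbasisP _)) addvC addv_diff.
  exact/addv_idPl.
have XYf : free (X ++ Y).
  rewrite cat_free Xf (basis_free (vbasisP _)) /=.
  rewrite (span_basis (vbasisP _)); apply/directv_addP.
  by rewrite capvC capv_diff.
exists (X ++ Y); split=> //; first by rewrite last_rcons.
move=> W; rewrite mem_rcons inE => /predU1P[->|Ws].
  by rewrite take_oversize // -[in leqRHS]spXY (eqP XYf).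
rewrite [LHS](XV _ Ws) takel_cat // -(eqP Xf).
rewrite dimvS // {1}(XV _ Ws); apply: sub_span => x; exact: mem_take.
Qed.

Definition std_basis n : seq 'rV[K]_n := [seq delta_mx 0 l | l <- enum 'I_n].

Definition stdv n (j : nat) : {vspace 'rV[K]_n} := <<take j (std_basis n)>>%VS.

Lemma size_std_basis n : size (std_basis n) = n.
Proof. by rewrite size_map size_enum_ord. Qed.

Lemma nth_std_basis n (l : 'I_n) : (std_basis n)`_l = delta_mx 0 l.
Proof. by rewrite (nth_map l) ?size_enum_ord// nth_ord_enum. Qed.

Lemma free_std_basis n : free (std_basis n).
Proof.
have sz := size_std_basis n.
rewrite -[X in free X](in_tupleE); apply/freeP => z z0 i.
have B_ (l : 'I_(size (std_basis n))) : (in_tuple (std_basis n))`_l = delta_mx 0 (cast_ord sz l).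
  exact: (nth_std_basis (cast_ord sz l)).
move: z0 => /rowP /(_ (cast_ord sz i)); rewrite summxE mxE (bigD1 i)//= big1.
  by rewrite mxE B_ mxE !eqxx mulr1 addr0.
move=> l li; rewrite mxE B_ mxE eqxx/= -val_eqE/= eq_sym val_eqE (negPf li).
by rewrite mulr0.
Qed.

Lemma dim_stdv n j : (j <= n)%N -> \dim (stdv n j) = j.
Proof.
move=> jn; have := free_std_basis n; rewrite -[X in free X](cat_take_drop j) cat_free.
case/and3P => /eqP + _ _; rewrite -/(stdv n j) => ->.
by rewrite size_takel// size_std_basis.
Qed.

Lemma mem_stdv n j (v : 'rV[K]_n) :
  v \in stdv n j <-> forall l : 'I_n, (j <= l)%N -> v 0 l = 0.
Proof.
split=> [|v0].
  move=> /coord_span -> l jl; rewrite summxE big1// => i _; rewrite mxE.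
  have li : (i < minn j n)%N.
    by apply: leq_trans (ltn_ord i) _; rewrite card_ord.
  move: li; rewrite leq_min => /andP[ij iN].
  rewrite (nth_take _ ij) (nth_std_basis (Ordinal iN)) mxE.
  rewrite (_ : (l == Ordinal iN) = false) ?andbF ?mulr0//.
  by apply/negbTE; rewrite -val_eqE /= gtn_eqF // (leq_trans ij).
rewrite [v]row_sum_delta; apply: memv_suml => l _.
have [jl|lj] := leqP j l; first by rewrite v0// scale0r mem0v.
apply: memvZ; apply: memv_span; apply/(nthP 0); exists l.
  by rewrite size_take_min size_std_basis leq_min lj /=.
by rewrite nth_take// nth_std_basis.
Qed.

Lemma stdvS n i j : (i <= j)%N -> (stdv n i <= stdv n j)%VS.
Proof.
move=> ij; apply/subvP => v /mem_stdv v0; apply/mem_stdv => l jl.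
by apply: v0; apply: leq_trans jl.
Qed.

End RowSpaces.


(** * Flags and tangent spaces *)

Section Flags.
Context (R : realType) (n k : nat).
Implicit Types (E : pflag R n k) (g h : 'M[R[i]]_n).

Lemma flag_actE E g i : flag_act E g i = vact (E i) g.
Proof. by rewrite ffunE. Qed.

Lemma flag_actM E g h : flag_act E (g *m h) = flag_act (flag_act E g) h.
Proof. by apply/ffunP => i; rewrite !flag_actE vactM. Qed.

Lemma flag_act1 E : flag_act E 1%:M = E.
Proof. by apply/ffunP => i; rewrite flag_actE vact1. Qed.

Lemma flag_manifold_act (a : k.-tuple nat) E g : g \in unitmx ->
  flag_manifold a E -> flag_manifold a (flag_act E g).
Proof.
move=> gu [dE EE]; split=> [i|i j ij]; first by rewrite flag_actE dim_vact.
by rewrite !flag_actE; apply: vactS; exact: EE.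
Qed.

(** Gram-Schmidt orthonormalisation keeps the spans of initial segments. *)
Lemma span_take_schmidt (X : seq 'rV[R[i]]_n) j : basis_of fullv X ->
  (<<take j X>> <= vact (stdv R[i] n j) (schmidt (\matrix_(l < n) X`_l)))%VS.
Proof.
move=> Xb; set M := \matrix_l _; set u := schmidt M.
have uu : u \in unitmx by apply: unitarymx_unit; exact: schmidt_unitarymx.
have sX : size X = n.
  by case/andP: Xb => /eqP XE /eqP <-; rewrite XE dimvf /dim /= mul1n.
apply/span_subvP => x /(nthP 0)[l]; rewrite size_take_min leq_min => /andP[lj lX].
rewrite nth_take// => <-; rewrite sX in lX.
have -> : X`_l = row (Ordinal lX) M by rewrite rowK.
rewrite mem_vact//; apply/mem_stdv => r jr.
(* Row [l] of [M] is a combination of the rows of [u] of index at most [l], and column [r] of the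
   inverse of [u] kills all rows of [u] except the one of index [r]. *)
have : (row (Ordinal lX) M <= kermx (col r (invmx u)))%MS.
  apply: submx_trans (row_schmidt_sub _ _) _; apply/sumsmx_subP => i il.
  rewrite genmxE; apply/sub_kermxP; rewrite colE mulmxA -row_mul mulmxV//.
  rewrite row1 mul_delta_mx_cond -val_eqE/= ltn_eqF ?mulr0n//.
  by apply: leq_ltn_trans il (leq_trans lj jr).
move/sub_kermxP/matrixP/(_ 0 0); rewrite [LHS]mxE [X in _ = X -> _]mxE => <-; rewrite mxE.
by apply/esym/eq_bigr => s _; rewrite !mxE.
Qed.

(** Gram-Schmidt applied to a basis adapted to the flag. This provides the compactness of the flag
    manifold: sequences of flags are represented by unitary matrices. *)
Lemma flag_unitary (a : k.-tuple nat) E : flag_manifold a E ->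
  exists2 u : 'M[R[i]]_n, u \is unitarymx &
    forall i, E i = vact (stdv R[i] n (tnth a i)) u.
Proof.
move=> [dE EE]; have [|X [Xb EX]] := @chain_basis _ _ [seq E i | i <- enum 'I_k].
  rewrite pairwise_map.
  have : pairwise leq [seq val i | i <- enum 'I_k].
    by rewrite val_enum_ord -sorted_pairwise ?iota_sorted//; exact: leq_trans.
  by rewrite pairwise_map; apply: sub_pairwise => i j; exact: EE.
exists (schmidt (\matrix_(l < n) X`_l)); first exact: schmidt_unitarymx.
move=> i; apply/eqP; rewrite eqEdim.
have Ei : E i = <<take (tnth a i) X>>%VS.
  by rewrite -(dE i); apply: EX; apply: map_f; rewrite mem_enum.
rewrite {1}Ei span_take_schmidt//= dim_vact; last first.
  by apply: unitarymx_unit; exact: schmidt_unitarymx.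
have an : (tnth a i <= n)%N.
  by rewrite -(dE i) (leq_trans (dimvS (subvf _)))// dimvf /dim /= mul1n.
by rewrite dim_stdv// dE.
Qed.

End Flags.

(** * Zariski tangent spaces as kernels of Jacobians *)

Section Tangent.
Context (R : realType) (n k : nat).
Implicit Types (E : pflag R n k) (X : set (pflag R n k)).

(** Membership in the ideal of the inverse image of [X] under the orbit map of [E]. *)
Definition vanishes_on X E (f : mpoly (n * n) R[i]) : Prop :=
  forall g, g \in unitmx -> X (flag_act E g) -> mxpoly_eval f g = 0.

Lemma mxpoly_diffE (f : mpoly (n * n) R[i]) g A :
  mxpoly_diff f g A = (mxvec A *m gradient f (mxvec g)) 0 0.
Proof. by rewrite mxE; apply: eq_bigr => u _; rewrite mxE mulrC. Qed.

Lemma mxpoly_diff_linear (f : mpoly (n * n) R[i]) g c A B :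
  mxpoly_diff f g (c *: A + B) = c * mxpoly_diff f g A + mxpoly_diff f g B.
Proof.
by rewrite !mxpoly_diffE linearP mulmxDl -scalemxAl !mxE.
Qed.

Lemma tangent_lift_vspace X E :
  exists T : {vspace 'M[R[i]]_n}, forall A, A \in T <-> tangent_lift X E A.
Proof.
apply: ex_vspace => [f _|c A B TA TB f fX].
  by rewrite mxpoly_diffE linear0 mul0mx mxE.
by rewrite mxpoly_diff_linear TA// TB// mulr0 addr0.
Qed.

(** Tangent vectors at [q] are written [A *m q], whence the factor [lin_mulmxr q]; Jacobians at
    different [q] thus act on the same space of matrices [A]. *)
Definition poly_jacobian d (f : 'I_d -> mpoly (n * n) R[i]) (q : 'M[R[i]]_n) :
    'M[R[i]]_(n * n, d) :=
  lin_mulmxr q *m \matrix_(u, j) gradient (f j) (mxvec q) u 0.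

Lemma mul_jacobian d (f : 'I_d -> mpoly (n * n) R[i]) (q A : 'M[R[i]]_n) j :
  (mxvec A *m poly_jacobian f q) 0 j = mxpoly_diff (f j) q (A *m q).
Proof.
rewrite mulmxA mul_vec_lin mxpoly_diffE !mxE.
by apply: eq_bigr => u _; rewrite !mxE.
Qed.

(** The gradients at 1 of the vanishing polynomials form a finite-dimensional space; polynomials
    realising a basis of it suffice. *)
Lemma tangent_lift_jacobian X E : exists d (f : 'I_d -> mpoly (n * n) R[i]),
  (forall j, vanishes_on X E (f j)) /\
  forall A, tangent_lift X E A <-> mxvec A *m poly_jacobian f 1%:M = 0.
Proof.
pose S := [set c : 'cV[R[i]]_(n * n) |
            exists2 f, vanishes_on X E f & c = gradient f (mxvec 1%:M)].
have [|c u v [f fX ->] [g gX ->]|W memW] := @ex_vspace _ _ S.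
- exists (mpolyC _ 0); last by rewrite gradientC.
  by move=> g _ _; rewrite /mxpoly_eval mevalC.
- exists (mpolyC _ c * f + g).
    move=> q qu Xq; rewrite /mxpoly_eval mevalD mevalM.
    by rewrite [meval _ f]fX// [meval _ g]gX// mulr0 addr0.
  by rewrite gradientD gradientM gradientC scaler0 add0r mevalC.
have /fin_all_exists2[f fX fW] (j : 'I_(\dim W)) :
    exists2 f, vanishes_on X E f & (vbasis W)`_j = gradient f (mxvec 1%:M).
  by apply/memW; apply: vbasis_mem; rewrite mem_nth// size_tuple.
exists (\dim W), f; split=> // A; split=> [TA|A0 g gX].
  by apply/rowP => j; rewrite mul_jacobian mulmx1 mxE; exact: (TA _ (fX j)).
have /memW/coord_vbasis gW : S (gradient g (mxvec 1%:M)) by exists g.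
rewrite mxpoly_diffE gW mulmx_sumr summxE big1// => j _.
by rewrite -scalemxAr mxE fW -mxpoly_diffE -[A]mulmx1 -mul_jacobian A0 mxE mulr0.
Qed.

(** If [g] moves [E p] to a flag that [h] sends into [X], then [p g h] moves [E] into [X], so [f j]
    composed with [g |-> p g h] vanishes at [g]. The differential at 1 of this composite along [A]
    is that of [f j] at [p h] along [p A h], which is [p A p^-1] times [p h]. *)
Lemma tangent_lift_translate X E (p h : 'M[R[i]]_n) d
    (f : 'I_d -> mpoly (n * n) R[i]) A :
  p \in unitmx -> h \in unitmx -> (forall j, vanishes_on X E (f j)) ->
  tangent_lift [set G | X (flag_act G h)] (flag_act E p) A ->
  mxvec (p *m A *m invmx p) *m poly_jacobian f (p *m h) = 0.
Proof.
move=> pu hu fX TA; apply/rowP => j; rewrite mul_jacobian mxE.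
have [f' ff'] := linear_substitution (lin_mulmx p *m lin_mulmxr h) (f j).
have Lg g : mxvec g *m (lin_mulmx p *m lin_mulmxr h) = mxvec (p *m g *m h).
  by rewrite mulmxA !mul_vec_lin.
have -> : mxpoly_diff (f j) (p *m h) (p *m A *m invmx p *m (p *m h)) =
    mxpoly_diff f' 1%:M A.
  rewrite !mxpoly_diffE; have [_ ->] := ff' (mxvec 1%:M).
  by rewrite [in RHS]mulmxA !Lg mulmx1 (mulmxA _ p h) mulmxKV.
apply: (TA f') => g gu Xg; rewrite /mxpoly_eval; have [-> _] := ff' (mxvec g).
rewrite Lg; apply: fX; first by rewrite !unitmx_mul pu gu.
by rewrite !flag_actM.
Qed.

End Tangent.

Section TangentLimits.
Context (R : realType) (n k : nat) (U : set_system nat) {UF : ProperFilter U}.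
Implicit Types (E : pflag R n k) (X : set (pflag R n k)).

Lemma mtends_lin_mulmxr (q : nat -> 'M[R[i]]_n) (z : 'M[R[i]]_n) : mtends U q z ->
  mtends U (fun k => lin_mulmxr (q k) : 'M[R[i]]_(n * n, n * n)) (lin_mulmxr z : 'M[R[i]]_(n * n, n * n)).
Proof.
move=> qz; split=> i j; rewrite mxE; under eq_fun do rewrite mxE.
have H := mtends_mxvec (mtendsM (mtends_cst (vec_mx 'e_i)) qz) 0 j; exact: H.
Qed.

Lemma mtends_jacobian d (f : 'I_d -> mpoly (n * n) R[i]) q z : mtends U q z ->
  mtends U (fun k => poly_jacobian f (q k)) (poly_jacobian f z).
Proof.
move=> qz; have L := mtends_lin_mulmxr qz.
have G : mtends U (fun k => \matrix_(u, j) gradient (f j) (mxvec (q k)) u 0)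
    (\matrix_(u, j) gradient (f j) (mxvec z) u 0).
  split=> u j; rewrite mxE; under eq_fun do rewrite mxE.
  have H := mtends_gradient (f j) (mtends_mxvec qz) u 0; exact: H.
by have H := mtendsM L G; exact: H.
Qed.

(** Coordinates [S] on [T] and the Jacobian at 1 together form an injective map, an open condition.
    Near the limit, conjugation by [p l] sends [T'] into the kernel of the Jacobian at [p l *m h l],
    where [S] alone is then injective. *)
Lemma tangent_semicontinuity X E (T : {vspace 'M[R[i]]_n}) (p h : nat -> 'M[R[i]]_n) :
  (forall A, A \in T <-> tangent_lift X E A) ->
  mtends U (fun l => p l *m h l) 1%:M ->
  \forall l \near U, p l \in unitmx -> h l \in unitmx ->
    forall T' : {vspace 'M[R[i]]_n},
    (forall A, A \in T' ->
       tangent_lift [set G | X (flag_act G (h l))] (flag_act E (p l)) A) ->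
    (\dim T' <= \dim T)%N.
Proof.
move=> memT ph1; have [d [f [fX Tf]]] := tangent_lift_jacobian X E.
have [Q [S [QS TQ]]] := mxspace_coordinates T.
have SJ : row_free (row_mx S (poly_jacobian f 1%:M)).
  apply: inj_row_free => v; rewrite mul_mx_row -[0]row_mx0 => /eq_row_mx[vS vJ].
  have /memT : tangent_lift X E (vec_mx v) by apply/Tf; rewrite vec_mxK.
  by rewrite TQ vec_mxK vS mul0mx eq_sym => /eqP.
have : \forall l \near U, row_free (row_mx S (poly_jacobian f (p l *m h l))).
  exact: mtends_row_free (mtends_row_mx (mtends_cst S) (mtends_jacobian f ph1)) SJ.
apply: filterS => l SJl pu hu T' T'l.
pose L : 'Hom('M[R[i]]_n, 'rV[R[i]]_(\dim T)) :=
  linfun (mulmxr S \o mxvec \o mulmxr (invmx (p l)) \o mulmx (p l)).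
have Lfree : (T' :&: lker L)%VS = 0%VS.
  apply/eqP; rewrite -subv0; apply/subvP => A; rewrite memv_cap memv_ker lfunE /=.
  case/andP => /T'l/(tangent_lift_translate pu hu fX) AJ /eqP AS.
  have : mxvec (p l *m A *m invmx (p l)) *m row_mx S (poly_jacobian f (p l *m h l)) = 0.
    by rewrite mul_mx_row AS AJ row_mx0.
  move/eqP; rewrite mulmx_free_eq0// mxvec_eq0 => /eqP pA0.
  by rewrite -[A](mulKmx pu) -[p l *m A](mulmxKV pu) pA0 mul0mx mulmx0 mem0v.
rewrite -(limg_dim_eq Lfree).
by apply: leq_trans (dimvS (subvf _)) _; rewrite dimvf /dim /= mul1n.
Qed.

End TangentLimits.


(** * Grassmannian permutations *)

Local Close Scope classical_set_scope.

Section PermutationLength.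
Context (n : nat).
Implicit Types (sigma : 'S_n).

Lemma card_ltn_ord (m : nat) : (m <= n)%N -> #|[set l : 'I_n | (l < m)%N]| = m.
Proof.
move=> mn; have -> : [set l : 'I_n | (l < m)%N] = [set widen_ord mn x | x : 'I_m].
  apply/setP => l; rewrite inE; apply/idP/imsetP => [lm|[x _ ->]]; last exact: (ltn_ord x).
  by exists (Ordinal lm) => //; apply: val_inj.
rewrite card_imset ?card_ord//.
by move=> x y /(congr1 val)/= xy; apply: val_inj.
Qed.

Lemma card_perm_ltn sigma (m : nat) : (m <= n)%N ->
  #|[set l : 'I_n | (sigma l < m)%N]| = m.
Proof.
move=> mn; rewrite -[RHS](card_ltn_ord mn).
have -> : [set l : 'I_n | (sigma l < m)%N] = sigma @^-1: [set l : 'I_n | (l < m)%N].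
  by apply/setP => l; rewrite !inE.
by rewrite card_preimset//; exact: perm_inj.
Qed.

Lemma card_perm_geq sigma (m : nat) : (m <= n)%N ->
  #|[set l : 'I_n | (n <= m + sigma l)%N]| = m.
Proof.
move=> mn; have := cardsC [set l : 'I_n | (sigma l < n - m)%N].
rewrite card_perm_ltn ?leq_subr// card_ord => cE.
have -> : [set l : 'I_n | (n <= m + sigma l)%N] = ~: [set l : 'I_n | (sigma l < n - m)%N].
  by apply/setP => l; rewrite !inE -leqNgt leq_subLR.
by lia.
Qed.

(** The entries of the Lehmer code of [sigma]. *)
Definition inversions_from sigma (l : 'I_n) : nat :=
  #|[set j : 'I_n | (l < j)%N && (sigma j < sigma l)%N]|.

Lemma perm_length_sum sigma : perm_length sigma = (\sum_l inversions_from sigma l)%N.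
Proof.
rewrite /perm_length -sum1_card.
rewrite (eq_bigl (fun p : 'I_n * 'I_n => true && ((p.1 < p.2)%N && (sigma p.2 < sigma p.1)%N)))//.
rewrite -(pair_big_dep xpredT (fun i j : 'I_n => (i < j)%N && (sigma j < sigma i)%N) (fun _ _ => 1%N)).
apply: eq_bigr => l _; rewrite sum1dep_card; apply: eq_card => j.
by rewrite !inE.
Qed.

(** The [sigma l] positions with a value below [sigma l] either precede [l] or form an inversion
    with it. *)
Lemma leq_inversions_from sigma (l : 'I_n) : (sigma l <= l + inversions_from sigma l)%N.
Proof.
rewrite -[X in (X <= _)%N](card_perm_ltn sigma (ltnW (ltn_ord (sigma l)))).
rewrite -[X in (X + _)%N](card_ltn_ord (ltnW (ltn_ord l))).
apply: leq_trans (leq_card_setU _ _).1; apply: subset_leq_card.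
apply/fintype.subsetP => j; rewrite !inE => jl; rewrite jl andbT.
case: ltngtP => // /val_inj jE; by rewrite jE ltnn in jl.
Qed.

Lemma grassmannian_descents sigma : grassmannian sigma -> descents sigma = [:: delta sigma].
Proof. by rewrite /grassmannian /delta; case: descents => [|d []]. Qed.

Lemma grassmannian_delta sigma : grassmannian sigma -> (0 < delta sigma < n)%N.
Proof.
move=> /grassmannian_descents sd.
have : delta sigma \in descents sigma by rewrite sd mem_head.
rewrite mem_filter mem_iota => /andP[_]; move: (delta sigma) => d; lia.
Qed.

Lemma grassmannian_homo sigma (i j : 'I_n) : grassmannian sigma -> (i < j)%N ->
  (j < delta sigma)%N || (delta sigma <= i)%N -> (sigma i < sigma j)%N.
Proof.
move=> sg ij id.
(* Indices start at 0 and descents at 1, so a descent from [p] to [q = p + 1] bears the number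
   [q]. *)
have step (p q : 'I_n) : q = p.+1 :> nat -> q != delta sigma :> nat -> (sigma p < sigma q)%N.
  move=> pq qd; rewrite ltnNge leq_eqVlt; apply/norP; split.
    apply/eqP => /val_inj/perm_inj pqE; by move: pq; rewrite pqE => /n_Sn.
  apply/negP => qp; have : val q \in descents sigma.
    rewrite mem_filter mem_iota; apply/andP; split; last first.
      by rewrite /= pq; have := ltn_ord q; lia.
    apply/existsP; exists p; apply/existsP; exists q; rewrite -pq !eqxx.
    exact: qp.
  by rewrite grassmannian_descents// inE (negPf qd).
suff claim d : forall q : 'I_n, q = (i + d).+1 :> nat ->
    (q < delta sigma)%N || (delta sigma <= i)%N -> (sigma i < sigma q)%N.
  by apply: (claim (j - i.+1)%N) => //; lia.
elim: d => [|d IHd] q qE qd.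
  by apply: step; rewrite ?qE ?addn0//; move: qd; rewrite qE; lia.
have pn : ((i + d).+1 < n)%N by have := ltn_ord q; lia.
apply: (@ltn_trans (sigma (Ordinal pn))).
  by apply: IHd => //=; lia.
by apply: step => /=; lia.
Qed.

End PermutationLength.

Local Open Scope classical_set_scope.

(** * Free families and matrices constrained row by row *)

Section LinearAlgebra.
Context (K : fieldType).

Lemma free_map_filter (I : Type) (vT : vectType K) (p : pred I) (w : I -> vT) (s : seq I) :
  free [seq w l | l <- s] -> free [seq w l | l <- s & p l].
Proof.
suff /perm_free <- : perm_eq ([seq w l | l <- s & p l] ++ [seq w l | l <- s & predC p l])
    [seq w l | l <- s] by rewrite cat_free => /and3P[].
rewrite -map_cat; elim: s => //= x s IHs; case: (p x) => /=; first by rewrite perm_cons.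
by rewrite map_cat /= perm_catC /= perm_cons perm_catC -map_cat.
Qed.

Lemma dim_fullrV n : \dim {: 'rV[K]_n} = n.
Proof. by rewrite dimvf /dim /= mul1n. Qed.

Lemma leq_dim_cap (vT : vectType K) (S U W : {vspace vT}) :
  (U <= S)%VS -> (W <= S)%VS -> (\dim U + \dim W <= \dim S + \dim (U :&: W))%N.
Proof.
move=> US WS; rewrite -dimv_sum_cap leq_add2r dimvS//.
by rewrite subv_add US.
Qed.

(** The vectors are chosen from the last index down: those of index above [l] span a space of
    dimension [d - l - 1], too small to contain [U l]. *)
Lemma free_choice (vT : vectType K) (d : nat) (U : nat -> {vspace vT}) :
  (forall l, (l < d)%N -> (d - l <= \dim (U l))%N) ->
  exists w : nat -> vT, free [seq w l | l <- iota 0 d] /\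
    forall l, (l < d)%N -> w l \in U l.
Proof.
elim: d U => [|d IHd] U dU.
  by exists (fun=> 0); split; first exact: nil_free.
have [w [wf wU]] := IHd (fun l => U l.+1) (fun l ld => dU l.+1 ld).
pose S := <<[seq w l | l <- iota 0 d]>>%VS.
have /subvPn[v vU vS] : ~~ (U 0%N <= S)%VS.
  apply/negP => /dimvS; apply/negP; rewrite -ltnNge.
  apply: leq_trans (dU 0%N isT); rewrite subn0 ltnS.
  by rewrite (eqP wf) size_map size_iota.
exists (fun l => if l is l'.+1 then w l' else v); split; last by case=> [|l] // /wU.
rewrite /= free_cons -[1%N]addn0 iotaDl -map_comp.
by rewrite (eq_map (g := w))// vS.
Qed.

Lemma basis_unitmx n (X : seq 'rV[K]_n) : basis_of fullv X ->
  \matrix_(i < n) X`_i \in unitmx.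
Proof.
move=> /andP[/eqP XE Xf].
have sX : size X = n by rewrite -(eqP Xf) XE dimvf /dim /= mul1n.
rewrite -row_free_unit; apply: inj_row_free => z.
rewrite mulmx_sum_row => z0; move: Xf; rewrite -[X in free X](in_tupleE) => /freeP Xf.
apply/rowP => i; rewrite mxE.
have := Xf (fun j => z 0 (cast_ord sX j)) _ (cast_ord (esym sX) i).
rewrite cast_ordKV; apply; rewrite -[RHS]z0.
rewrite (reindex (cast_ord sX))/=; last by exists (cast_ord (esym sX)) => j _; rewrite ?cast_ordK ?cast_ordKV.
by apply: eq_bigr => j _; rewrite rowK.
Qed.

Lemma free_unitmx n d (w : nat -> 'rV[K]_n) : free [seq w l | l <- iota 0 d] ->
  exists2 M : 'M[K]_n, M \in unitmx & forall l : 'I_n, (l < d)%N -> row l M = w l.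
Proof.
move=> wf; set W := [seq w l | l <- iota 0 d] in wf *.
pose Y := vbasis (<<W>>^C).
have sY : <<Y>>%VS = (<<W>>^C)%VS by exact: span_basis (vbasisP _).
exists (\matrix_(i < n) (W ++ Y)`_i).
  apply: basis_unitmx; apply/andP; rewrite span_cat sY addv_complf eqxx; split=> //.
  rewrite cat_free wf (basis_free (vbasisP _)) sY; apply/directv_addP.
  exact: capv_compl.
move=> l ld; rewrite rowK nth_cat size_map size_iota ld.
by rewrite (nth_map 0%N) ?size_iota// nth_iota.
Qed.

(** As [M] is invertible, the rows of [M *m A] can be prescribed independently, so [W] is a direct
    sum of copies of the [V l]. *)
Lemma dim_row_constraints n (M : 'M[K]_n) (V : 'I_n -> {vspace 'rV[K]_n}) :
  M \in unitmx -> exists W : {vspace 'M[K]_n},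
    (forall A, A \in W <-> forall l, row l M *m A \in V l) /\
    \dim W = (\sum_l \dim (V l))%N.
Proof.
move=> Mu.
pose L l : 'Hom('rV[K]_n, 'M[K]_n) := linfun (mulmx (invmx M *m delta_mx l 0)).
have rowL l l' v : row l M *m L l' v = if l == l' then v else 0.
  rewrite lfunE /= mulmxA mulmxA -row_mul mulmxV// row1 mul_delta_mx_cond.
  case: eqP => _; last by rewrite mulr0n mul0mx.
  have -> : delta_mx 0 0 = 1%:M :> 'M[K]_1 by apply/matrixP => i j; rewrite !ord1 !mxE.
  by rewrite mul1mx.
have Linj l v : L l v = 0 -> v = 0.
  by move=> Lv; have := rowL l l v; rewrite Lv mulmx0 eqxx.
exists (\sum_l L l @: V l)%VS; split.
  move=> A; split=> [/memv_sumP[B BV ->] l|AV].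
    rewrite mulmx_sumr; apply: memv_suml => l' _.
    have /memv_imgP[v vV ->] := BV l' isT.
    by rewrite rowL; case: eqP => [->//|_]; rewrite mem0v.
  have -> : A = \sum_l L l (row l M *m A).
    apply: (can_inj (mulKmx Mu)); apply/row_matrixP => l.
    rewrite !row_mul mulmx_sumr (bigD1 l)//= big1 ?addr0 ?rowL ?eqxx//.
    by move=> l' ll'; rewrite rowL eq_sym (negPf ll').
  by apply: memv_sumr => l _; exact: memv_img.
have /directvP /= -> : directv (\sum_l L l @: V l).
  apply/directv_sum_independent => B BV B0 l _.
  have /memv_imgP[v vV Bl] := BV l isT.
  suff -> : B l = L l (row l M *m \sum_j B j) by rewrite B0 mulmx0 linear0.
  rewrite mulmx_sumr (bigD1 l)//= big1 ?addr0; first by rewrite Bl rowL eqxx.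
  move=> l' ll'; have /memv_imgP[v' _ ->] := BV l' isT.
  by rewrite rowL eq_sym (negPf ll').
apply: eq_bigr => l _; apply: limg_dim_eq; apply/eqP; rewrite -subv0.
apply/subvP => v; rewrite memv_cap memv_ker => /andP[_ /eqP/Linj ->].
exact: mem0v.
Qed.

End LinearAlgebra.


(** * Schubert varieties *)

Section TangentCurves.
Context (R : realType) (n k : nat).
Implicit Types (E : pflag R n k) (X : set (pflag R n k)).

Lemma tends_harmonic : tends \oo (fun m => (m.+1%:R^-1)%:C) (0 : R[i]).
Proof.
have /tends_real_complex : tends \oo (fun m => m.+1%:R^-1) (0 : R) := cvg_harmonic.
exact.
Qed.

Lemma mtends_line (A : 'M[R[i]]_n) :
  mtends \oo (fun m => 1%:M + (m.+1%:R^-1)%:C *: A) 1%:M.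
Proof.
rewrite -[X in mtends _ _ X]addr0 -[X in _ + X](scale0r A).
apply: mtendsD; first exact: mtends_cst.
by apply: mtendsZ; [exact: tends_harmonic | exact: mtends_cst].
Qed.

(** A vanishing polynomial is 0 at 1 and at [1 + u A] for [u = 1/(m+1)] with [m] large; its
    difference quotients, all 0, tend to its differential along [A]. *)
Lemma tangent_lift_line X E (A : 'M[R[i]]_n) :
  (forall u, 1%:M + u *: A \in unitmx -> X (flag_act E (1%:M + u *: A))) ->
  tangent_lift X E A.
Proof.
move=> XA f fX; rewrite mxpoly_diffE.
have f1 : meval (mxvec 1%:M 0) f = 0.
  apply: fX; first exact: unitmx1.
  by have := XA 0; rewrite scale0r addr0; apply; exact: unitmx1.
have [G Gf fG] := mpoly_difference_quotient f
  (mtends_mxvec (mtends_line A)) (mtends_cst (mxvec 1%:M)).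
have AG : mtends \oo (fun m => mxvec A *m G m) (mxvec A *m gradient f (mxvec 1%:M)).
  by apply: mtendsM Gf; exact: mtends_cst.
apply: tends_unique (AG 0 0) _.
apply: (@tends_ev _ _ _ (fun=> 0)); last exact: tends_cst.
have : \forall m \near \oo, 1%:M + (m.+1%:R^-1)%:C *: A \in unitmx.
  exact: mtends_unitmx (mtends_line A) (unitmx1 _ _).
apply: filterS => m gu; have := fG m; rewrite f1 subr0.
rewrite [meval _ f]fX//; last exact: XA.
rewrite linearD addrAC subrr add0r linearZ -scalemxAl mxE => /esym/eqP.
rewrite mulf_eq0 => /predU1P[|/eqP//].
by move=> /complexI/eqP; rewrite invr_eq0 pnatr_eq0.
Qed.

End TangentCurves.

Section Schubert.
Context (R : realType) (n k : nat) (a : k.-tuple nat) (sigma : 'S_n) (c : 'I_k).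
Hypotheses (sigmaG : grassmannian sigma) (deltaE : tnth a c = delta sigma).
Context (F : nat -> {vspace 'rV[R[i]]_n}) (h : 'M[R[i]]_n).
Hypotheses (hu : h \in unitmx)
  (Fh : forall j, (j <= n)%N -> F j = vact (stdv R[i] n j) h).

Let d := delta sigma.

Let dn : (d <= n)%N.
Proof. by have /andP[_ /ltnW] := grassmannian_delta sigmaG. Qed.

Lemma dim_reference j : (j <= n)%N -> \dim (F j) = j.
Proof. by move=> jn; rewrite Fh// dim_vact// dim_stdv. Qed.

Lemma sub_reference i j : (i <= j <= n)%N -> (F i <= F j)%VS.
Proof.
case/andP => ij jn; rewrite !Fh ?(leq_trans ij)//.
by apply: vactS; exact: stdvS.
Qed.

Lemma iota_ord : iota 0 d = [seq val l | l <- enum 'I_n & (val l < d)%N].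
Proof.
rewrite -(filter_map val (fun l => (l < d)%N)) val_enum_ord.
by rewrite (@filter_iota_ltn 0 n d).
Qed.

(* For a Grassmannian permutation the rank conditions at the single step
   [E c] imply those at all other steps. *)
Lemma schubert_criterion E (w : nat -> 'rV[R[i]]_n) :
  flag_manifold a E -> free [seq w l | l <- iota 0 d] ->
  (forall l : 'I_n, (l < d)%N -> w l \in (E c :&: F (n - sigma l))%VS) ->
  schubert_variety a sigma F E.
Proof.
move=> Efl wf wEF; have [dE EE] := Efl.
split=> // i j /andP[j1 jn].
(* [P] holds the positions counted by the condition at [j], and [L m] the first [m] positions. *)
pose P := [set l : 'I_n | (n <= j + sigma l)%N]%SET.
pose L m := [set l : 'I_n | (l < m)%N]%SET.
have -> : #|[pred l : 'I_n | (l < tnth a i)%N & (n < j + (sigma l).+1)%N]| =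
    #|L (tnth a i) :&: P|%SET.
  by apply: eq_card => l; rewrite !inE addnS ltnS.
have an i' : (tnth a i' <= n)%N.
  by rewrite -(dE i') (leq_trans (dimvS (subvf _)))// dim_fullrV.
have Pc : (#|L d :&: P|%SET <= \dim (E c :&: F j))%N.
  pose s := [seq l <- [seq l <- enum 'I_n | (val l < d)%N] | l \in P].
  have sf : free [seq w (val l) | l <- s].
    apply: free_map_filter; move: wf; rewrite iota_ord -map_comp.
    by rewrite (eq_map (g := fun l : 'I_n => w (val l))).
  have -> : #|L d :&: P|%SET = size s.
    rewrite cardE /s -filter_predI; congr size; rewrite {1}/enum_mem enumT.
    by apply: eq_filter => l; rewrite !inE andbC.
  rewrite -(size_map (fun l => w (val l))) -(eqP sf); apply: dimvS.
  apply/span_subvP => _ /mapP[l + ->].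
  rewrite !mem_filter inE => /and3P[lP ld _].
  have := wEF l ld; rewrite !memv_cap => /andP[-> wl] /=.
  by apply: subvP (sub_reference _) _ wl; have := ltn_ord (sigma l); lia.
have [ic|ci] := leqP i c.
  have aE : (tnth a i <= d)%N by rewrite -(dE i) /d -deltaE -(dE c) dimvS// EE.
  (* As [sigma] increases before the descent, one counted position below [tnth a i] puts all
     positions from [tnth a i] to [d - 1] in [P]. Passing from [E c] to [E i] loses at most
     [d - tnth a i] dimensions, exactly the drop in the count. *)
  have [->|[l0]] := set_0Vmem (L (tnth a i) :&: P)%SET; first by rewrite cards0.
  rewrite !inE => /andP[l0a l0P].
  have := cardsUI (L d :&: P)%SET (L (tnth a i)).
  have -> : (L d :&: P :&: L (tnth a i) = L (tnth a i) :&: P)%SET.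
    apply/setP => l; rewrite !inE.
    by case: (boolP (l < tnth a i)%N) => [la|]; rewrite ?andbF// andbT (leq_trans la).
  have -> : (L d :&: P :|: L (tnth a i) = L d)%SET.
    apply/setP => l; rewrite !inE.
    case: (ltnP l (tnth a i)) => la; first by rewrite orbT (leq_trans la).
    rewrite orbF; case: (ltnP l d) => //= ld.
    have := @grassmannian_homo _ _ l0 l sigmaG (leq_trans l0a la).
    by rewrite ld => /(_ isT); lia.
  rewrite !card_ltn_ord// => cE.
  have := leq_dim_cap (EE _ _ ic) (capvSl (E c) (F j)).
  rewrite !dE capvA (capv_idPl (EE _ _ ic)) deltaE -/d; lia.
have ci' := ltnW ci.
(* If a counted position lies past the descent, all positions from [tnth a i] on are in [P], and the
   bound is the one valid for any two subspaces of these dimensions. Otherwise only positions before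
   the descent count, and the bound for [E c] suffices. *)
have [l0|APD] := pickP [pred l in L (tnth a i) :&: P | d <= l]%N.
  rewrite !inE => /andP[/andP[l0a l0P] l0d].
  have := cardsUI P (L (tnth a i)).
  have -> : (P :|: L (tnth a i) = [set: 'I_n])%SET.
    apply/setP => l; rewrite !inE; case: (ltnP l (tnth a i)) => la; first by rewrite orbT.
    have := @grassmannian_homo _ _ l0 l sigmaG (leq_trans l0a la).
    by rewrite -/d l0d orbT => /(_ isT); lia.
  rewrite finset.setIC cardsT card_ord card_perm_geq// card_ltn_ord// => cE.
  have := leq_dim_cap (subvf (E i)) (subvf (F j)).
  by rewrite dE dim_reference// dim_fullrV; lia.
apply: leq_trans (leq_trans Pc (dimvS (capvS (EE _ _ ci') (subvv _)))).
apply: subset_leq_card; apply/fintype.subsetP => l; rewrite !inE => /andP[la lP].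
by have := APD l; rewrite /= !inE la lP /= => /negbT; rewrite -ltnNge => ->.
Qed.

(** Extension of [sigma] to [nat] by a dummy value, for use with [free_choice]. *)
Definition perm_value (l : nat) : nat := if insub l is Some i then sigma i else 0.

Lemma perm_valueE (l : 'I_n) : perm_value l = sigma l.
Proof. by rewrite /perm_value valK. Qed.

(** The condition at [F (n - sigma l)] counts the positions [x < d] with [sigma x >= sigma l]. Since
    [sigma] increases there, they include [l, ..., d - 1], which gives the dimension [d - l]
    required by [free_choice]. *)
Lemma schubert_frame E : schubert_variety a sigma F E ->
  exists w : nat -> 'rV[R[i]]_n, free [seq w l | l <- iota 0 d] /\
    forall l : 'I_n, (l < d)%N -> w l \in (E c :&: F (n - sigma l))%VS.
Proof.
move=> [Efl EX].
have [l ld|w [wf wU]] := @free_choice _ _ d (fun l => E c :&: F (n - perm_value l))%VS.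
  have ln := leq_trans ld dn; have := EX c (n - sigma (Ordinal ln))%N.
  rewrite (perm_valueE (Ordinal ln)) => /(_ _)/(leq_trans _); apply; last first.
    by have := ltn_ord (sigma (Ordinal ln)); lia.
  rewrite leq_subLR; set m := #|_|.
  pose D := [set x : 'I_n | (x < d)%N && (n < n - sigma (Ordinal ln) + (sigma x).+1)%N]%SET.
  have -> : m = #|D| by apply: eq_card => x; rewrite !inE deltaE.
  rewrite -[X in (X <= _)%N](card_ltn_ord dn) -[X in (X + _)%N](card_ltn_ord (ltnW ln)).
  apply: leq_trans (leq_card_setU _ _).1.
  apply: subset_leq_card; apply/fintype.subsetP => x; rewrite !inE => xd.
  rewrite xd /=; case: ltngtP => //= [lx|xl].
    have := @grassmannian_homo _ _ (Ordinal ln) x sigmaG lx.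
    by rewrite xd => /(_ isT); lia.
  have -> : x = Ordinal ln by exact: val_inj.
  by have := ltn_ord (sigma (Ordinal ln)); lia.
by exists w; split=> // l /wU; rewrite perm_valueE.
Qed.

(* Together with [w l \in E c :&: F (n - sigma l)], this says that [E] lies in the
   open Schubert cell. *)
Definition generic_frame (w : nat -> 'rV[R[i]]_n) : Prop :=
  forall l : 'I_n, (l < d)%N -> (w l *m invmx h) 0 (rev_ord (sigma l)) != 0.

(** The vectors [w q] are adjoined to [F (n - sigma l)] for [q] from [l - 1] down to 0. All that
    precedes lies in [F (n - sigma q - 1)], whereas genericity keeps [w q] out of it, so each one
    adds a dimension. *)
Lemma leq_dim_generic E (w : nat -> 'rV[R[i]]_n) (l : 'I_n) :
  generic_frame w ->
  (forall l : 'I_n, (l < d)%N -> w l \in (E c :&: F (n - sigma l))%VS) ->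
  (l < d)%N -> (n - sigma l + l <= \dim (E c + F (n - sigma l)))%N.
Proof.
move=> wg wEF ld.
pose S r := (<<[seq w q | q <- iota (l - r) r]>> + F (n - sigma l))%VS.
have S_le : (S l <= E c + F (n - sigma l))%VS.
  apply: addvS => //; apply/span_subvP => _ /mapP[q + ->].
  rewrite mem_iota subnn add0n => /andP[_ ql].
  have := wEF (Ordinal (ltn_trans ql (ltn_ord l))) (ltn_trans ql ld).
  by rewrite memv_cap => /andP[].
apply: leq_trans (dimvS S_le).
suff claim r : (r <= l)%N -> (n - sigma l + r <= \dim (S r))%N by exact: claim.
elim: r => [_|r IHr rl].
  by rewrite /S /= span_nil add0v dim_reference ?addn0// leq_subr.
rewrite addnS; apply: leq_ltn_trans (IHr (ltnW rl)) _.
have qn : (l - r.+1 < n)%N by have := ltn_ord l; lia.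
pose q := Ordinal qn.
have qd : (q < d)%N by rewrite /=; lia.
have SS : S r.+1 = (<[w q]> + S r)%VS.
  rewrite /S /= span_cons addvA; congr (<[_]> + <<_>> + _)%VS.
  by congr map; congr iota; lia.
suff wS : w q \notin S r.
  rewrite ltnNge; apply/negP => dS; have /eqP SE : S r == S r.+1.
    by rewrite eqEdim {1}SS addvSr.
  by move/negP: wS; apply; rewrite SE SS; apply: subvP (addvSl _ _) _ (memv_line _).
have Ssub : (S r <= F (n - (sigma q).+1))%VS.
  rewrite subv_add; apply/andP; split.
    apply/span_subvP => _ /mapP[p + ->]; rewrite mem_iota => pr.
    have pn : (p < n)%N by have := ltn_ord l; lia.
    have qp : (q < Ordinal pn)%N by rewrite /=; lia.
    have pd : (Ordinal pn < d)%N by rewrite /=; lia.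
    have := wEF (Ordinal pn) pd; rewrite memv_cap => /andP[_].
    apply: subvP; apply: sub_reference.
    have := @grassmannian_homo _ _ q (Ordinal pn) sigmaG qp.
    by rewrite pd => /(_ isT); lia.
  apply: sub_reference; have ql : (q < l)%N by rewrite /=; lia.
  have := @grassmannian_homo _ _ q l sigmaG ql.
  by rewrite ld => /(_ isT); lia.
apply: contra (wg q qd) => /(subvP Ssub); rewrite Fh ?leq_subr// mem_vact//.
by move=> /mem_stdv ->.
Qed.

(** [W] consists of the [A] sending each [w l] with [l < d] into [E c + F (n - sigma l)];
    [leq_dim_generic] and the Lehmer code bound its codimension by the length of [sigma]. *)
Lemma tangent_generic E (w : nat -> 'rV[R[i]]_n) :
  flag_manifold a E -> free [seq w l | l <- iota 0 d] -> generic_frame w ->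
  (forall l : 'I_n, (l < d)%N -> w l \in (E c :&: F (n - sigma l))%VS) ->
  exists W : {vspace 'M[R[i]]_n},
    (forall A, A \in W -> tangent_lift (schubert_variety a sigma F) E A) /\
    (n * n <= \dim W + perm_length sigma)%N.
Proof.
move=> Efl wf wg wEF.
have [M Mu Mw] := free_unitmx wf.
have [W [memW dW]] := dim_row_constraints
  (fun l : 'I_n => if (l < d)%N then E c + F (n - sigma l) else fullv)%VS Mu.
exists W; split; last first.
  rewrite dW perm_length_sum -big_split /= -[X in (X * _)%N]card_ord -sum_nat_const.
  apply: leq_sum => l _; case: ifP => ld.
    have := leq_dim_generic wg wEF ld; have := leq_inversions_from sigma l.
    by have := ltn_ord (sigma l); lia.
  by rewrite dimvf /dim /= mul1n leq_addr.
have Ec : E c = <<[seq w l | l <- iota 0 d]>>%VS.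
  apply/esym/eqP; rewrite eqEdim (eqP wf) size_map size_iota.
  rewrite (proj1 Efl) deltaE leqnn andbT; apply/span_subvP => _ /mapP[l + ->].
  rewrite mem_iota => /andP[_ ld]; have := wEF (Ordinal (leq_trans ld dn)) ld.
  by rewrite memv_cap => /andP[].
have wE l : (l < d)%N -> w l \in E c.
  by move=> ld; rewrite Ec; apply: memv_span; apply: map_f; rewrite mem_iota.
move=> A /memW AW.
have /fin_all_exists2[v vE vF] (l : 'I_n) : exists2 v, v \in E c &
    (l < d)%N -> w l *m A - v \in F (n - sigma l).
  have := AW l; case: ifP => ld; last by exists 0; rewrite ?mem0v.
  rewrite Mw// => /memv_addP[v vE [u uF ->]]; exists v => // _.
  by rewrite addrAC subrr add0r.
(* [B] preserves [E c], and [A - B] sends each [w l] into [F (n - sigma l)]. Both directions are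
   tangent to lines in the Schubert variety: along [A - B] the moved frame meets the criterion,
   along [B] the frame [w] itself does. *)
pose B := invmx M *m \matrix_l v l.
have wB (l : 'I_n) : (l < d)%N -> w l *m B = v l.
  by move=> ld; rewrite -Mw// /B -row_mul mulKVmx// rowK.
have [T memT] := tangent_lift_vspace (schubert_variety a sigma F) E.
rewrite -(subrK B A); apply/memT; apply: memvD; apply/memT.
  apply: tangent_lift_line => u gu.
  apply: (schubert_criterion (w := fun l => w l *m (1%:M + u *: (A - B)))).
  - exact: flag_manifold_act.
  - rewrite (_ : [seq _ | l <- _] = map (linfun (mulmxr (1%:M + u *: (A - B)))) [seq w l | l <- iota 0 d]).
      apply/eqP; rewrite -limg_span [LHS](dim_vact _ gu) (eqP wf).
      by rewrite !size_map.
    by rewrite -map_comp; apply: eq_map => l; rewrite /= lfunE.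
  - move=> l ld; rewrite memv_cap flag_actE memv_vact ?wE//=.
    rewrite mulmxDr mulmx1 -scalemxAr mulmxBr wB//.
    have := wEF l ld; rewrite memv_cap => /andP[_ wF].
    by apply: memvD => //; apply: memvZ; exact: vF.
apply: tangent_lift_line => u gu.
have EcB : flag_act E (1%:M + u *: B) c = E c.
  apply/eqP; rewrite flag_actE eqEdim dim_vact// leqnn andbT.
  rewrite {1}Ec /vact limg_span; apply/span_subvP => _ /mapP[_ /mapP[l + ->] ->].
  rewrite mem_iota => /andP[_ ld]; rewrite lfunE /= mulmxDr mulmx1 -scalemxAr.
  rewrite (wB (Ordinal (leq_trans ld dn)))//.
  by apply: memvD; [exact: wE | apply: memvZ; exact: vE].
apply: (schubert_criterion (w := w)) => //; first exact: flag_manifold_act.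
by move=> l ld; rewrite EcB; exact: wEF.
Qed.

(* Moving a frame of [E] by [w l + u f_l], where [f_l] is the last basis vector
   of the flag step that must contain [w l], puts it in the open cell for all
   small [u != 0]; tangent spaces can only grow in the limit [u --> 0]. *)
Lemma leq_dim_tangent E (T : {vspace 'M[R[i]]_n}) :
  schubert_variety a sigma F E ->
  (forall A, A \in T <-> tangent_lift (schubert_variety a sigma F) E A) ->
  (n * n <= \dim T + perm_length sigma)%N.
Proof.
move=> EX memT; have [w [wf wEF]] := schubert_frame EX.
have [Efl _] := EX.
have [M Mu Mw] := free_unitmx wf.
pose A := invmx M *m \matrix_l (row (rev_ord (sigma l)) h).
have wA (l : 'I_n) : (l < d)%N -> w l *m A = row (rev_ord (sigma l)) h.
  by move=> ld; rewrite -Mw// /A -row_mul mulKVmx// rowK.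
pose u m : R[i] := (m.+1%:R^-1)%:C.
pose g m := 1%:M + u m *: A.
have g1 : mtends \oo g 1%:M by exact: mtends_line.
have wg m (l : 'I_n) : (l < d)%N ->
    (w l *m g m *m invmx h) 0 (rev_ord (sigma l)) =
    (w l *m invmx h) 0 (rev_ord (sigma l)) + u m.
  move=> ld; rewrite mulmxDr mulmx1 mulmxDl -scalemxAr wA// -scalemxAl -row_mul.
  by rewrite mulmxV// row1 !mxE !eqxx mulr1.
have gen : \forall m \near \oo, generic_frame (fun l => w l *m g m).
  have : \forall m \near \oo, forall l : 'I_n, (l < d)%N ->
      (w l *m g m *m invmx h) 0 (rev_ord (sigma l)) != 0.
    apply: filter_forall => l; have [ld|ld] := ltnP l d; last by apply: nearW => m /negP.
    set z := (w l *m invmx h) 0 (rev_ord (sigma l)).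
    have [z0|z0] := eqVneq z 0.
      apply: nearW => m _; rewrite wg// -/z z0 add0r.
      by rewrite /u fmorph_eq0 invr_eq0 pnatr_eq0.
    have : tends \oo (fun m => z + u m) z.
      rewrite -[X in tends _ _ X]addr0; apply: tendsD (tends_cst z) _.
      exact: tends_harmonic.
    move/(tends_neq0 z0); apply: filterS => m zm _; by rewrite wg.
  by apply: filterS => m wm l; exact: wm.
have gu : \forall m \near \oo, g m \in unitmx.
  exact: mtends_unitmx g1 (unitmx1 _ _).
have g1' : mtends \oo (fun m => g m *m 1%:M) 1%:M.
  rewrite -[X in mtends _ _ X](mulmx1 1%:M); apply: mtendsM => //; exact: mtends_cst.
have sc := tangent_semicontinuity (UF := eventually_filter) memT g1'.
have [m [[genm gum] scm]] := filter_ex (filterI (filterI gen gu) sc).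
have [||||W [WT dW]] := @tangent_generic (flag_act E (g m)) (fun l => w l *m g m).
- exact: flag_manifold_act.
- rewrite (_ : [seq _ | l <- _] = map (linfun (mulmxr (g m))) [seq w l | l <- iota 0 d]).
    apply/eqP; rewrite -limg_span [LHS](dim_vact _ gum) (eqP wf).
    by rewrite !size_map.
  by rewrite -map_comp; apply: eq_map => l; rewrite /= lfunE.
- exact: genm.
- move=> l ld; have := wEF l ld; rewrite !memv_cap flag_actE => /andP[wE wF].
  rewrite memv_vact//= mulmxDr mulmx1 -scalemxAr wA//.
  apply: memvD => //; apply: memvZ; rewrite Fh ?leq_subr// rowE mem_vact// mulmxK//.
  apply/mem_stdv => l' l'n; rewrite mxE eqxx /= -val_eqE /=.
  by rewrite gtn_eqF//; have := ltn_ord (sigma l); lia.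
apply: leq_trans dW _; rewrite leq_add2r; apply: scm => //; first exact: unitmx1.
move=> B /WT; congr tangent_lift; apply/funext => G /=.
by rewrite flag_act1.
Qed.

End Schubert.


(** * Stability of transverse intersections *)

Section StabilizerAlgebra.
Context (R : realType) (n k : nat).
Implicit Types (E : pflag R n k).

Lemma stabilizer_algebraP E (A : 'M[R[i]]_n) :
  stabilizer_algebra E A <-> forall i v, v \in E i -> v *m A \in E i.
Proof.
split=> [EA i v vE|EA i]; last by apply/subvP => _ /vactP[v vE ->]; exact: EA.
by apply: subvP (EA i) _ (memv_vact A vE).
Qed.

Lemma stabilizer_algebra_vspace E :
  exists P : {vspace 'M[R[i]]_n}, forall A, A \in P <-> stabilizer_algebra E A.
Proof.
apply: ex_vspace => [|c A B]; first by apply/stabilizer_algebraP => i v _; rewrite mulmx0 mem0v.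
move=> /stabilizer_algebraP EA /stabilizer_algebraP EB.
apply/stabilizer_algebraP => i v vE; rewrite mulmxDr -scalemxAr.
by apply: memvD; [apply: memvZ; exact: EA | exact: EB].
Qed.

Lemma flag_act_stabilizer E (g : 'M[R[i]]_n) : g \in unitmx ->
  stabilizer_algebra E g -> flag_act E g = E.
Proof.
move=> gu Eg; apply/ffunP => i; apply/eqP.
by rewrite flag_actE eqEdim dim_vact// leqnn andbT; exact: Eg.
Qed.

Lemma stabilizer_algebra_act E (p A : 'M[R[i]]_n) : p \in unitmx ->
  stabilizer_algebra (flag_act E p) A <->
  stabilizer_algebra E (p *m A *m invmx p).
Proof.
move=> pu; split=> /stabilizer_algebraP EA; apply/stabilizer_algebraP => i v.
  move=> vE; have := EA i (v *m p); rewrite flag_actE => /(_ (memv_vact _ vE)).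
  by rewrite mem_vact// !mulmxA.
rewrite flag_actE => /vactP[w wE ->]; rewrite mem_vact//.
by have := EA i w wE; rewrite !mulmxA.
Qed.

Lemma stabilizer_tangent (X : set (pflag R n k)) E (A : 'M[R[i]]_n) : X E ->
  stabilizer_algebra E A -> tangent_lift X E A.
Proof.
move=> XE /stabilizer_algebraP EA; apply: tangent_lift_line => u gu.
rewrite flag_act_stabilizer//; apply/stabilizer_algebraP => i v vE.
by rewrite mulmxDr mulmx1 -scalemxAr memvD// memvZ// EA.
Qed.

(** Row [l] of [u] lies in every [E i] with [l < tnth a i], so a stabilizing matrix sends it into
    the intersection of these steps; the codimensions of these targets sum to at least
    [flag_dim n a]. *)
Lemma dim_stabilizer_algebra (a : k.-tuple nat) E (P : {vspace 'M[R[i]]_n}) :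
  flag_type n a -> flag_manifold a E ->
  (forall A, A \in P <-> stabilizer_algebra E A) ->
  (\dim P + flag_dim n a <= n * n)%N.
Proof.
move=> [_ asort _] Efl memP; have [dE EE] := Efl.
have [u /unitarymx_unit uu Eu] := flag_unitary Efl.
have [W [memW dW]] := dim_row_constraints
  (fun l : 'I_n => (\bigcap_(i < k | (l < tnth a i)%N) E i)%VS) uu.
have PW : (P <= W)%VS.
  apply/subvP => A /memP/stabilizer_algebraP EA; apply/memW => l.
  rewrite memvE; apply/subv_bigcapP => i la; rewrite -memvE; apply: EA.
  rewrite Eu rowE memv_vact//; apply/mem_stdv => l' al'.
  by rewrite mxE eqxx /= -val_eqE/= gtn_eqF// (leq_trans la).
apply: leq_trans (leq_add (dimvS PW) (leqnn _)) _; rewrite {}dW.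
(* [J i] indexes the vectors of an adapted basis spanning the i-th step of the
   flag modulo the previous one. *)
pose J (i : 'I_k) := [set l : 'I_n | (nth 0 (0 :: a) i <= l < tnth a i)%N]%N%SET.
have a_nth (i : 'I_k) : tnth a i = nth 0%N (0%N :: a) i.+1 by rewrite (tnth_nth 0%N).
have an (i : 'I_k) : (tnth a i <= n)%N.
  by rewrite -(dE i) (leq_trans (dimvS (subvf _)))// dim_fullrV.
have a_mono : {in [pred i | (i <= k)%N] &, {homo nth 0%N (0%N :: a) : i j / (i <= j)%N}}.
  move=> i j ik jk ij; apply: (@sorted_leq_nth _ leq leq_trans leqnn 0%N) => //.
  - have : sorted ltn (0%N :: a) || sorted leq (0%N :: a).
      apply/orP; right; rewrite /=; move: asort; case: (tval a) => //= x s xs.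
      by apply: sub_path xs => p q /ltnW.
    by case/orP => // /(sub_sorted (fun p q => @ltnW p q)).
  - by rewrite inE /= size_tuple ltnS.
  - by rewrite inE /= size_tuple ltnS.
have cardJ i : (#|J i| = tnth a i - nth 0 (0 :: a) i)%N.
  have ai : (nth 0%N (0%N :: a) i <= tnth a i)%N.
    by rewrite a_nth; apply: a_mono; rewrite ?inE// ltnW.
  have := cardsUI (J i) [set l : 'I_n | (l < nth 0%N (0%N :: a) i)%N]%SET.
  have -> : (J i :&: [set l : 'I_n | (l < nth 0%N (0%N :: a) i)%N] = finset.set0)%SET.
    by apply/setP => l; rewrite !inE; lia.
  have -> : (J i :|: [set l : 'I_n | (l < nth 0%N (0%N :: a) i)%N] =
      [set l : 'I_n | (l < tnth a i)%N])%SET.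
    by apply/setP => l; rewrite !inE; lia.
  by rewrite cards0 addn0 !card_ltn_ord// ?(leq_trans ai)// => ->; rewrite addnK.
have Jdisj l (i j : 'I_k) : l \in J i -> l \in J j -> i = j.
  have H (i' j' : 'I_k) : (i' < j')%N -> l \in J i' -> l \notin J j'.
    rewrite !inE => ij /andP[_ li]; apply/negP => /andP[lj _].
    have : (tnth a i' <= nth 0%N (0%N :: a) j')%N.
      rewrite a_nth; apply: a_mono => //; rewrite inE; first exact: ltn_ord.
      exact: ltnW.
    by lia.
  move=> li lj; apply: val_inj; case: (ltngtP i j) => // ij.
    by move: lj; rewrite (negPf (H _ _ ij li)).
  by move: li; rewrite (negPf (H _ _ ij lj)).
have : (flag_dim n a <= \sum_(l < n) (n - \dim (\bigcap_(i < k | (l < tnth a i)%N) E i)%VS))%N.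
  rewrite /flag_dim.
  under eq_bigr => i _ do rewrite -cardJ mulnC -sum_nat_const.
  rewrite (exchange_big_dep xpredT)//=; apply: leq_sum => l _.
  have [i0 li0|none] := pickP [pred i | l \in J i]; last by rewrite big_pred0.
  rewrite (big_pred1 i0) => [|i]; last first.
    by apply/idP/eqP => [li|->//]; exact: Jdisj li li0.
  apply: leq_sub2l; rewrite -(dE i0); apply: dimvS; apply: bigcapv_inf => //.
  by move: li0; rewrite /= inE => /andP[].
set fd := flag_dim _ _ => fdle.
apply: leq_trans (leq_add (leqnn _) fdle) _; rewrite -big_split /=.
rewrite -[X in (_ <= X * _)%N]card_ord -sum_nat_const; apply: leq_sum => l _.
by rewrite subnKC// (leq_trans (dimvS (subvf _)))// dim_fullrV.
Qed.

End StabilizerAlgebra.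

(** * Semicontinuity of intersections and closed rank conditions *)

Section Semicontinuity.
Context (R : realType) (U : set_system nat) {UF : ProperFilter U}.

Lemma leq_dim_injective (K : fieldType) (vT : vectType K) d (L : 'Hom(vT, 'rV[K]_d))
    (T : {vspace vT}) : (T :&: lker L)%VS = 0%VS -> (\dim T <= d)%N.
Proof.
move=> Linj; rewrite -(limg_dim_eq Linj).
by apply: leq_trans (dimvS (subvf _)) _; rewrite dim_fullrV.
Qed.

Lemma vspace_equations (K : fieldType) n (V : {vspace 'rV[K]_n}) :
  exists N : 'M[K]_n, forall v, (v \in V) = (v *m N == 0).
Proof.
have [Q [S [_ memV]]] := vspace_coordinates (erefl (\dim V)).
exists (1%:M - S *m Q) => v.
by rewrite memV mulmxBr mulmx1 mulmxA subr_eq0 eq_sym.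
Qed.

(** Coordinates on [V :&: W] and equations of both spaces together form an injective map. This
    persists near the limit, where the coordinates alone are injective on the moved intersection. *)
Lemma cap_semicontinuity n (V W : {vspace 'rV[R[i]]_n}) (q : nat -> 'M[R[i]]_n) :
  mtends U q 1%:M ->
  \forall l \near U, (\dim (vact V (q l) :&: W) <= \dim (V :&: W))%N.
Proof.
move=> q1; have [N VN] := vspace_equations V; have [N' WN'] := vspace_equations W.
have [Q [S [QS VWQ]]] := vspace_coordinates (erefl (\dim (V :&: W))).
have Sf : row_free (row_mx S (row_mx (invmx 1%:M *m N) N')).
  apply: inj_row_free => v; rewrite !mul_mx_row -[0]row_mx0 => /eq_row_mx[vS].
  rewrite -[0]row_mx0 => /eq_row_mx[vN vN'].
  have : v \in (V :&: W)%VS.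
    by rewrite memv_cap VN WN' vN' eqxx andbT; rewrite invmx1 mul1mx in vN; rewrite vN.
  by rewrite VWQ vS mul0mx eq_sym => /eqP.
have lim : mtends U (fun l => row_mx S (row_mx (invmx (q l) *m N) N'))
    (row_mx S (row_mx (invmx 1%:M *m N) N')).
  apply: mtends_row_mx; first exact: mtends_cst.
  apply: mtends_row_mx; last exact: mtends_cst.
  apply: mtendsM; last exact: mtends_cst.
  exact: mtendsV q1 (unitmx1 _ _).
have qu : \forall l \near U, q l \in unitmx by exact: mtends_unitmx q1 (unitmx1 _ _).
have fr : \forall l \near U, row_free (row_mx S (row_mx (invmx (q l) *m N) N')).
  exact: mtends_row_free lim Sf.
near=> l; have qul : q l \in unitmx by near: l.
have frl : row_free (row_mx S (row_mx (invmx (q l) *m N) N')) by near: l.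
apply: (@leq_dim_injective _ _ _ (linfun (mulmxr S))).
apply/eqP; rewrite -subv0; apply/subvP => v; rewrite !memv_cap memv_ker lfunE /=.
rewrite mem_vact// VN WN' => /andP[/andP[/eqP vN /eqP vN'] /eqP vS].
have : v *m row_mx S (row_mx (invmx (q l) *m N) N') = 0.
  by rewrite !mul_mx_row mulmxA vN vN' vS !row_mx0.
by move/eqP; rewrite mulmx_free_eq0// memv0.
Unshelve. all: by end_near. Qed.

Lemma schubert_closed n k (a : k.-tuple nat) (sigma : 'S_n)
    (F : nat -> {vspace 'rV[R[i]]_n}) (E : pflag R n k) (q : nat -> 'M[R[i]]_n) :
  flag_manifold a E -> mtends U q 1%:M ->
  (\forall l \near U, schubert_variety a sigma F (flag_act E (q l))) ->
  schubert_variety a sigma F E.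
Proof.
move=> Efl q1 EX; split=> // i j jn.
have [l [[_ EXl] dl]] := filter_ex (filterI EX (cap_semicontinuity (E i) (F j) q1)).
by apply: leq_trans dl; have := EXl i j jn; rewrite flag_actE.
Qed.

Lemma lin_mulmxr1 n : lin_mulmxr 1%:M = 1%:M :> 'M[R[i]]_(n * n).
Proof.
by apply/row_matrixP => l; rewrite !rowE mulmx1 mul_rV_lin /= mulmx1 vec_mxK.
Qed.

Lemma mtends_mxrow m r (d : 'I_m -> nat) (M : nat -> forall j, 'M[R[i]]_(r, d j))
    (A : forall j, 'M[R[i]]_(r, d j)) :
  (forall j, mtends U (fun l => M l j) (A j)) ->
  mtends U (fun l => \mxrow_j M l j) (\mxrow_j A j).
Proof.
move=> MA; split=> i j; rewrite mxE; under eq_fun do rewrite mxE.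
exact: (MA (tagnat.sig1 j) i (tagnat.sig2 j)).
Qed.

End Semicontinuity.

(** * Perturbation of a transverse intersection point *)

Section TransversePoint.
Context (R : realType) (n k m : nat) (U : set_system nat) {UF : ProperFilter U}.
Context (X : 'I_m -> set (pflag R n k)) (E : pflag R n k).
Hypothesis (XT : forall A, (forall i, tangent_lift (X i) E A) ->
  stabilizer_algebra E A).
Context (h : 'I_m -> nat -> 'M[R[i]]_n).
Hypotheses (h1 : forall i, mtends U (h i) 1%:M).

(** By transversality the common kernel of the Jacobians lies in the stabilizer algebra, on which
    the coordinates [S] are injective. *)
Lemma transverse_jacobian : exists (d : 'I_m -> nat)
    (f : forall i, 'I_(d i) -> mpoly (n * n) R[i])
    (r : nat) (Q : 'M[R[i]]_(r, n * n)) (S : 'M[R[i]]_(n * n, r)),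
  [/\ forall i j, vanishes_on (X i) E (f i j), Q *m S = 1%:M,
      forall A, stabilizer_algebra E A <-> mxvec A *m S *m Q = mxvec A &
      row_free (row_mx S (\mxrow_i poly_jacobian (f i) 1%:M))].
Proof.
have /fin_all_exists[d] := fun i => tangent_lift_jacobian (X i) E.
case/fin_all_exists => f fT.
have [P memP] := stabilizer_algebra_vspace E.
have [Q [S [QS PQ]]] := mxspace_coordinates P.
have memQ A : stabilizer_algebra E A <-> mxvec A *m S *m Q = mxvec A.
  by rewrite -memP PQ; split=> /eqP.
exists d, f, _, Q, S; split=> //; first by move=> i j; exact: (fT i).1.
apply: inj_row_free => v; rewrite mul_mx_row mul_mxrow -[0]row_mx0 => /eq_row_mx[vS].
rewrite -[0]mxrow0 => /eq_mxrowP vJ.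
have /memQ : stabilizer_algebra E (vec_mx v).
  by apply: XT => i; apply/(fT i).2; rewrite vec_mxK; exact: vJ.
by rewrite vec_mxK vS mul0mx => <-.
Qed.

(* The implicit function theorem without charts: the element [b] of the
   stabilizer puts [q - b p] in a fixed complement of the stabilizer algebra, on
   which the matrix [J] of difference quotients is injective, because its limit,
   the Jacobian at [E], is. *)
Lemma transverse_unique (p q : nat -> 'M[R[i]]_n) :
  mtends U p 1%:M -> mtends U q 1%:M ->
  (\forall l \near U, forall i, X i (flag_act (flag_act E (p l)) (h i l))) ->
  (\forall l \near U, forall i, X i (flag_act (flag_act E (q l)) (h i l))) ->
  \forall l \near U, flag_act E (p l) = flag_act E (q l).
Proof.
move=> p1 q1 pX qX.
have [d [f [r [Q [S [fX QS memQ JS]]]]]] := transverse_jacobian.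
(* In coordinates: right multiplication by [p l] on the stabilizer algebra, followed by projection
   back to it. *)
pose L l := Q *m lin_mulmxr (p l) *m S.
have L1 : mtends U L 1%:M.
  rewrite -QS -[Q in X in mtends _ _ X]mulmx1 -lin_mulmxr1.
  apply: mtendsM; last exact: mtends_cst.
  by apply: mtendsM (mtends_lin_mulmxr p1); exact: mtends_cst.
(* The solution of [y l *m L l = mxvec (q l) *m S], which says that the stabilizer coordinates of
   [q l - b l *m p l] vanish. *)
pose y l := mxvec (q l) *m S *m invmx (L l).
pose b l : 'M[R[i]]_n := vec_mx (y l *m Q).
have bP l : stabilizer_algebra E (b l).
  by apply/memQ; rewrite vec_mxK -(mulmxA _ Q) QS mulmx1.
have b1 : mtends U b 1%:M.
  have /memQ E1 : stabilizer_algebra E 1%:M.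
    by apply/stabilizer_algebraP => i v; rewrite mulmx1.
  rewrite -[X in mtends _ _ X]mxvecK -E1; apply: mtends_vec_mx.
  apply: mtendsM; last exact: mtends_cst.
  rewrite -[X in mtends _ _ X]mulmx1 -[X in _ *m X]invmx1.
  apply: mtendsM; last exact: mtendsV L1 (unitmx1 _ _).
  by apply: mtendsM (mtends_mxvec q1) _; exact: mtends_cst.
have qh i : mtends U (fun l => mxvec (q l *m h i l)) (mxvec 1%:M).
  by apply: mtends_mxvec; rewrite -[X in mtends _ _ X](mulmx1 1%:M); exact: mtendsM.
have bph i : mtends U (fun l => mxvec (b l *m p l *m h i l)) (mxvec 1%:M).
  apply: mtends_mxvec; rewrite -[X in mtends _ _ X](mulmx1 1%:M).
  apply: mtendsM => //; rewrite -[X in mtends _ _ X](mulmx1 1%:M).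
  exact: mtendsM.
(* For almost all [l], both [q l *m h i l] and [b l *m p l *m h i l] send [E] into [X i], so the
   [f i j] vanish at both and the difference quotients kill [q l - b l *m p l]. *)
have /fin_all_exists[G GE] (i : 'I_m) : exists G : 'I_(d i) -> nat -> 'cV[R[i]]_(n * n),
    forall j, mtends U (G j) (gradient (f i j) (mxvec 1%:M)) /\
      forall l, meval (mxvec (q l *m h i l) 0) (f i j) -
                meval (mxvec (b l *m p l *m h i l) 0) (f i j) =
        ((mxvec (q l *m h i l) - mxvec (b l *m p l *m h i l)) *m G j l) 0 0.
  have /fin_all_exists[G Gj] (j : 'I_(d i)) : exists G : nat -> 'cV[R[i]]_(n * n),
      mtends U G (gradient (f i j) (mxvec 1%:M)) /\
      forall l, meval (mxvec (q l *m h i l) 0) (f i j) -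
                meval (mxvec (b l *m p l *m h i l) 0) (f i j) =
        ((mxvec (q l *m h i l) - mxvec (b l *m p l *m h i l)) *m G l) 0 0.
    have [G G1 G2] := mpoly_difference_quotient (f i j) (qh i) (bph i).
    by exists G.
  by exists G.
pose J l := \mxrow_i (lin_mulmxr (h i l) *m \matrix_(u, j) G i j l u 0).
have J1 : mtends U J (\mxrow_i poly_jacobian (f i) 1%:M).
  apply: mtends_mxrow => i; apply: mtendsM; first exact: mtends_lin_mulmxr.
  split=> u j; rewrite mxE; under eq_fun do rewrite mxE.
  exact: ((GE i j).1 u 0).
have JSl : \forall l \near U, row_free (row_mx S (J l)).
  by apply: mtends_row_free JS; apply: mtends_row_mx J1; exact: mtends_cst.
have Lu : \forall l \near U, L l \in unitmx by exact: mtends_unitmx L1 (unitmx1 _ _).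
have bu : \forall l \near U, b l \in unitmx by exact: mtends_unitmx b1 (unitmx1 _ _).
have pu : \forall l \near U, p l \in unitmx by exact: mtends_unitmx p1 (unitmx1 _ _).
have qu : \forall l \near U, q l \in unitmx by exact: mtends_unitmx q1 (unitmx1 _ _).
have hu : \forall l \near U, forall i, h i l \in unitmx.
  by apply: filter_forall => i; exact: mtends_unitmx (h1 i) (unitmx1 _ _).
near=> l.
have bul : b l \in unitmx by near: l.
have pul : p l \in unitmx by near: l.
have qul : q l \in unitmx by near: l.
have hul i : h i l \in unitmx by move: i; near: l.
have Lul : L l \in unitmx by near: l.
have JSll : row_free (row_mx S (J l)) by near: l.
have Eb : flag_act E (b l) = E by exact: flag_act_stabilizer.
suff -> : q l = b l *m p l by rewrite flag_actM Eb.
apply/eqP; rewrite -subr_eq0 -mxvec_eq0 -(mulmx_free_eq0 _ JSll).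
rewrite mul_mx_row mul_mxrow.
have -> : mxvec (q l - b l *m p l) *m S = 0.
  have -> : mxvec (q l - b l *m p l) = mxvec (q l) - y l *m Q *m lin_mulmxr (p l).
    by rewrite linearB /= -[y l *m Q]vec_mxK mul_vec_lin.
  have yL : y l *m Q *m lin_mulmxr (p l) *m S = y l *m L l by rewrite /L !mulmxA.
  by rewrite mulmxBl yL /y mulmxKV ?subrr.
suff -> : \mxrow_i (mxvec (q l - b l *m p l) *m
    (lin_mulmxr (h i l) *m \matrix_(u, j) G i j l u 0)) = 0 by rewrite row_mx0.
rewrite -[RHS]mxrow0; apply/eq_mxrowP => i; apply/rowP => j.
rewrite mulmxA mul_vec_lin /= mulmxBl linearB !mxE.
have := (GE i j).2 l.
have -> : meval (mxvec (q l *m h i l) 0) (f i j) = 0.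
  apply: fX; first by rewrite unitmx_mul qul hul.
  by rewrite flag_actM; move: i {j}; near: l.
have -> : meval (mxvec (b l *m p l *m h i l) 0) (f i j) = 0.
  apply: fX; first by rewrite !unitmx_mul bul pul hul.
  by rewrite !flag_actM Eb; move: i {j}; near: l.
rewrite subrr mxE => GE0; rewrite [RHS]GE0; apply: eq_bigr => u _.
by congr (_ * _); rewrite mxE.
Unshelve. all: by end_near. Qed.

(** Let [B] be the conjugate of [A] by [p l] and [b] its projection to the stabilizer algebra of
    [E]. The Jacobians at [p l *m h i l] kill [B] by tangency of [A], and [b] because stabilizing
    directions are tangent. As [S] kills [B - b] too, injectivity near the limit gives [B = b]. *)
Lemma transverse_stable (p : nat -> 'M[R[i]]_n) : mtends U p 1%:M ->
  (\forall l \near U, forall i, X i (flag_act (flag_act E (p l)) (h i l))) ->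
  \forall l \near U, forall A,
    (forall i, tangent_lift [set G | X i (flag_act G (h i l))] (flag_act E (p l)) A) ->
    stabilizer_algebra (flag_act E (p l)) A.
Proof.
move=> p1 pX.
have [d [f [r [Q [S [fX QS memQ JS]]]]]] := transverse_jacobian.
have JSl : \forall l \near U,
    row_free (row_mx S (\mxrow_i poly_jacobian (f i) (p l *m h i l))).
  apply: mtends_row_free JS; apply: mtends_row_mx; first exact: mtends_cst.
  apply: mtends_mxrow => i; apply: mtends_jacobian.
  by rewrite -[X in mtends _ _ X](mulmx1 1%:M); exact: mtendsM.
have pu : \forall l \near U, p l \in unitmx by exact: mtends_unitmx p1 (unitmx1 _ _).
have hu : \forall l \near U, forall i, h i l \in unitmx.
  by apply: filter_forall => i; exact: mtends_unitmx (h1 i) (unitmx1 _ _).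
near=> l => A TA.
have pul : p l \in unitmx by near: l.
have hul i : h i l \in unitmx by move: i; near: l.
have JSll : row_free (row_mx S (\mxrow_i poly_jacobian (f i) (p l *m h i l))) by near: l.
apply/stabilizer_algebra_act => //; set B := p l *m A *m invmx (p l).
pose b : 'M[R[i]]_n := vec_mx (mxvec B *m S *m Q).
have bP : stabilizer_algebra E b.
  by apply/memQ; rewrite vec_mxK -(mulmxA _ Q) QS mulmx1.
suff -> : B = b by [].
apply/eqP; rewrite -subr_eq0 -mxvec_eq0 -(mulmx_free_eq0 _ JSll).
rewrite mul_mx_row mul_mxrow linearB.
have -> : (mxvec B - mxvec b) *m S = 0.
  by rewrite mulmxBl vec_mxK -(mulmxA _ Q) QS mulmx1 subrr.
suff -> : \mxrow_i ((mxvec B - mxvec b) *m poly_jacobian (f i) (p l *m h i l)) = 0.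
  by rewrite row_mx0.
rewrite -[RHS]mxrow0; apply/eq_mxrowP => i; rewrite mulmxBl.
have := tangent_lift_translate pul (hul i) (fX i) (TA i); rewrite -/B => ->.
pose b' := invmx (p l) *m b *m p l.
have bE : b = p l *m b' *m invmx (p l).
  by rewrite /b' !mulmxA mulmxV// mul1mx mulmxK.
suff /(tangent_lift_translate pul (hul i) (fX i)) : tangent_lift
    [set G | X i (flag_act G (h i l))] (flag_act E (p l)) b'.
  by rewrite -bE => ->; rewrite subrr.
apply: stabilizer_tangent; first by move: i; near: l.
by apply/(stabilizer_algebra_act _ _ pul); rewrite -bE; exact: bP.
Unshelve. all: by end_near. Qed.

End TransversePoint.


(** * Secant and osculating flags *)

Section NewtonMatrix.
Context (R : realType) (n : nat).

(* Linear forms on [R^n] are polynomials of degree [< n], via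
   [p |-> (gamma x |-> p.[x])] on the moment curve. A flag spanned by points
   of the curve with parameters [X j] is dual to the Newton polynomials
   [\prod_(x <- X j) ('X - x)]; the osculating flag is the confluent case. *)
Definition newton_poly (s : seq R) : {poly R} := \prod_(x <- s) ('X - x%:P).

Definition newton_mx (X : nat -> seq R) : 'M[R]_n :=
  \matrix_(r, j) (newton_poly (X j))`_r.

Lemma size_newton_poly s : size (newton_poly s) = (size s).+1.
Proof. exact: size_prod_XsubC. Qed.

(** The matrix is triangular with diagonal 1, since column [j] holds the coefficients of a monic
    polynomial of degree [j]. *)
Lemma newton_mx_unit (X : nat -> seq R) :
  (forall j, (j < n)%N -> size (X j) = j) -> newton_mx X \in unitmx.
Proof.
move=> sX; rewrite -unitmx_tr unitmxE det_trig; last first.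
  apply/is_trig_mxP => i j ij; rewrite !mxE nth_default//.
  by rewrite size_newton_poly sX.
rewrite big1 ?unitr1// => i _; rewrite !mxE.
have : newton_poly (X i) \is monic by exact: monic_prod_XsubC.
by move/monicP; rewrite lead_coefE size_newton_poly sX.
Qed.

Lemma mul_newton_mx (X : nat -> seq R) (p : 'I_n -> R) j :
  (\row_r p r *m newton_mx X) 0 j = \sum_(r < n) (newton_poly (X j))`_r * p r.
Proof. by rewrite mxE; apply: eq_bigr => r _; rewrite !mxE mulrC. Qed.

Lemma moment_newton_mx (X : nat -> seq R) x (j : 'I_n) : size (X j) = j ->
  (moment_curve n x *m newton_mx X) 0 j = (newton_poly (X j)).[x].
Proof.
move=> sX; rewrite mul_newton_mx (@horner_coef_wide _ n)//.
by rewrite size_newton_poly sX.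
Qed.

(** Coefficients depend continuously on the roots. Convergence of the roots is expressed through
    arbitrary selections, which avoids numbering them. *)
Lemma tends_newton_poly (U : set_system nat) {UF : ProperFilter U} j
    (X : nat -> seq R) t :
  (forall l, size (X l) = j) ->
  (forall x : nat -> R, (forall l, x l \in X l) -> tends U x t) ->
  forall r, tends U (fun l => (newton_poly (X l))`_r) (newton_poly (nseq j t))`_r.
Proof.
elim: j X => [|j IHj] X sX Xt r.
  under eq_fun => l do rewrite (size0nil (sX l)).
  exact: tends_cst.
pose x l := head t (X l); pose Y l := behead (X l).
have XE l : X l = x l :: Y l by rewrite /x /Y; case: (X l) (sX l).
have xt : tends U x t by apply: Xt => l; rewrite XE mem_head.
have Yt : forall r, tends U (fun l => (newton_poly (Y l))`_r) (newton_poly (nseq j t))`_r.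
  apply: IHj => [l|y yY]; first by have := sX l; rewrite XE => -[].
  by apply: Xt => l; rewrite XE inE yY orbT.
have coefE (z : R) (s : seq R) : (newton_poly (z :: s))`_r =
    (if r == 0%N then 0 else (newton_poly s)`_r.-1) + - (z * (newton_poly s)`_r).
  by rewrite /newton_poly big_cons mulrBl coefB coefXM coefCM.
rewrite [nseq _ _]/= coefE; under eq_fun => l do rewrite XE coefE.
apply: tendsD; first by case: eqP => _; [exact: tends_cst | exact: Yt].
by apply: tendsN; apply: tendsM.
Qed.

End NewtonMatrix.

Section CurveFlags.
Context (R : realType) (n : nat) (gamma : R -> 'rV[R]_n) (g : 'M[R]_n).
Hypotheses (gu : g \in unitmx) (gammaE : forall t, gamma t = moment_curve n t *m g).

Lemma derive1n_curve l t :
  derive1n l gamma t = \row_(r < n) ('X^r)^`(l).[t] *m g.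
Proof.
have -> : \row_(r < n) ('X^r)^`(l).[t] *m g =
    \row_c (\sum_(r < n) g r c *: 'X^r)^`(l).[t].
  apply/rowP => c; rewrite !mxE (linear_sum (derivn l)) horner_sum; apply: eq_bigr => r _.
  by rewrite mxE /= derivnZ hornerZ mulrC.
elim: l t => [|l IHl] t.
  rewrite derive1n0 gammaE; apply/rowP => c; rewrite !mxE derivn0 horner_sum.
  by apply: eq_bigr => r _; rewrite mxE hornerZ hornerXn mulrC.
rewrite derive1nS (funext IHl) derive1E derive_mx.
  by apply/rowP => c; rewrite !mxE derivnS derivE derive1E; under eq_fun do rewrite mxE.
apply/derivable_mxP => i c; under eq_fun do rewrite mxE.
exact: derivable_horner.
Qed.

Lemma derivn_newton_nseq (t : R) l j :
  (newton_poly (nseq j t))^`(l).[t] = l`!%:R *+ (l == j).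
Proof.
have -> : newton_poly (nseq j t) = ('X - t%:P) ^+ j.
  by rewrite /newton_poly big_nseq iter_mulr_1.
elim: l j => [|l IHl] j.
  by rewrite derivn0 horner_exp hornerXsubC subrr expr0n eq_sym.
case: j => [|j]; first by rewrite expr0 -[1]/(1%:P) derivnC /= horner0.
rewrite derivSn deriv_exp derivXsubC mul1r derivnMn hornerMn IHl eqSS.
by case: eqP => [->|_]; rewrite ?mulr0n ?mul0rn// !mulr1n factS natrM mulr_natl.
Qed.

(** Powers of [X - t] are dual, up to factorials, to derivatives at [t]. In the corresponding frame
    the derivative of order [l] of the curve is [l!] times the basis vector of index [l]. *)
Lemma osculating_flagE t j : (j <= n)%N ->
  osculating_flag gamma t j =
  vact (stdv R[i] n j) (map_mx (real_complex R) (invmx (newton_mx n (fun j => nseq j t)) *m g)).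
Proof.
move=> jn; set N := newton_mx _ _; set h := map_mx _ _.
have Nu : N \in unitmx by apply: newton_mx_unit => l _; rewrite size_nseq.
have gE (l : 'I_n) : to_complex (derive1n l gamma t) = (l`!%:R)%:C *: (delta_mx 0 l *m h).
  rewrite derive1n_curve scalemxAl -[(l`!%:R)%:C *: delta_mx 0 l]/(_ *: _).
  have -> : (l`!%:R)%:C *: delta_mx 0 l = map_mx (real_complex R) (l`!%:R *: delta_mx 0 l) :> 'rV[R[i]]_n.
    by rewrite map_mxZ map_delta_mx.
  rewrite -map_mxM mulmxA; congr (map_mx _ (_ *m g)).
  apply: (canRL (mulmxK Nu)); apply/rowP => c; rewrite mul_newton_mx !mxE.
  have PE : newton_poly (nseq c t) = \poly_(r < n) (newton_poly (nseq c t))`_r.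
    apply/polyP => r; rewrite coef_poly; case: ltnP => // nr; rewrite nth_default//.
    by rewrite size_newton_poly size_nseq (leq_trans (ltn_ord c)).
  have := derivn_newton_nseq t l c; rewrite {1}PE poly_def (linear_sum (derivn l)) horner_sum.
  under eq_bigr => r _ do rewrite /= derivnZ hornerZ.
  by move=> ->; rewrite eq_sym mulr_natr.
apply/eqP; rewrite eqEsubv; apply/andP; split.
  apply/span_subvP => _ /mapP[l + ->]; rewrite mem_iota add0n => /andP[_ lj].
  have ln := leq_trans lj jn; rewrite (gE (Ordinal ln)); apply/memvZ/memv_vact.
  apply/mem_stdv => l' jl'; rewrite mxE eqxx /= -val_eqE /= gtn_eqF//.
  exact: leq_trans jl'.
apply/subvP => _ /vactP[v /mem_stdv v0 ->]; rewrite [v]row_sum_delta mulmx_suml.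
apply: memv_suml => l _; have [jl|lj] := leqP j l.
  by rewrite v0// scale0r mul0mx mem0v.
rewrite -scalemxAl; apply: memvZ.
have l0 : (l`!%:R)%:C != 0 :> R[i].
  by rewrite fmorph_eq0 pnatr_eq0 -lt0n fact_gt0.
rewrite -[delta_mx _ _ *m h](scalerK l0) -gE; apply/memvZ/memv_span.
by apply: map_f; rewrite mem_iota.
Qed.

Lemma span_free_subseq (K : fieldType) (vT : vectType K) (T : eqType) (f : T -> vT) (s : seq T) :
  exists s', [/\ {subset s' <= s}, free [seq f x | x <- s'] &
    <<[seq f x | x <- s']>>%VS = <<[seq f x | x <- s]>>%VS].
Proof.
elim: s => [|x s [s' [s's s'f s'E]]]; first by exists [::]; rewrite nil_free.
have [fx|fx] := boolP (f x \in <<[seq f y | y <- s']>>%VS).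
  exists s'; split=> //; first by move=> y /s's ys; rewrite inE ys orbT.
  by rewrite /= span_cons -s'E; apply/esym/addv_idPr.
exists (x :: s'); split=> [y||]; last by rewrite /= !span_cons s'E.
  by rewrite !inE => /orP[->//|/s's ->]; rewrite orbT.
by rewrite /= free_cons fx.
Qed.

(** A free subfamily of the spanning points gives [X j] of size [j]; these sets need not be nested.
    For [l >= j] the Newton polynomial of [X l] vanishes on [X l], so the dual linear form kills
    [F l] and hence [F j]; dimensions do the rest. *)
Lemma secant_flag_newton I (F : nat -> {vspace 'rV[R[i]]_n}) : (0 < n)%N ->
  secant_flag gamma I F -> exists X : nat -> seq R,
  [/\ forall j, (j < n)%N -> size (X j) = j,
      forall j x, (j < n)%N -> x \in X j -> x \in I &
      forall j, (j <= n)%N -> F j =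
        vact (stdv R[i] n j) (map_mx (real_complex R) (invmx (newton_mx n X) *m g))].
Proof.
move=> n0 [[dF FF] Fs].
have /choice[X XP] (j : nat) : exists X : seq R, (j < n)%N ->
    [/\ size X = j, forall x, x \in X -> x \in I &
        F j = <<[seq to_complex (gamma x) | x <- X]>>%VS].
  have [jn|] := ltnP j n; last by exists [::].
  case: j jn => [|j] jn.
    exists [::] => _; split=> //; rewrite span_nil.
    by apply/eqP; rewrite -dimv_eq0 dF.
  have [s [sI Fj]] := Fs j.+1 jn.
  have [s' [s's s'f s'E]] := span_free_subseq (fun x => to_complex (gamma x)) s.
  exists s' => _; split; last by rewrite s'E.
    by have := eqP s'f; rewrite s'E -Fj dF ?(ltnW jn)// size_map.
  by move=> x /s's /sI[].
have sX j : (j < n)%N -> size (X j) = j by move=> /XP[].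
have Nu := newton_mx_unit sX.
exists X; split=> //; first by move=> j x /XP[_ + _]; apply.
move=> j jn; set h := map_mx _ _.
have hu : h \in unitmx by rewrite map_unitmx unitmx_mul unitmx_inv Nu.
apply/eqP; rewrite eqEdim dF// dim_vact// dim_stdv// leqnn andbT.
apply/subvP => v vF; rewrite mem_vact//; apply/mem_stdv => l jl.
have : v \in F l by apply: subvP vF; apply: FF; rewrite jl ltnW.
have [_ _ ->] := XP l (ltn_ord l).
pose phi : 'Hom('rV[R[i]]_n, 'rV[R[i]]_1) := linfun (mulmxr (col l (invmx h))).
have phiE w : phi w 0 0 = (w *m invmx h) 0 l.
  by rewrite lfunE /= !mxE; apply: eq_bigr => r _; rewrite !mxE.
rewrite -phiE => vX; suff /subvP/(_ _ vX) : (<<[seq to_complex (gamma x) | x <- X l]>> <= lker phi)%VS.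
  by rewrite memv_ker => /eqP ->; rewrite mxE.
apply/span_subvP => _ /mapP[x xX ->]; rewrite memv_ker; apply/eqP/rowP => i.
have -> : to_complex (gamma x) =
    map_mx (real_complex R) (moment_curve n x *m newton_mx n X) *m h.
  by rewrite /h -map_mxM mulmxA mulmxK// -gammaE.
rewrite !ord1 phiE [RHS]mxE mulmxK// mxE moment_newton_mx ?sX//.
suff -> : (newton_poly (X l)).[x] = 0 by [].
by apply/rootP; rewrite root_prod_XsubC.
Qed.

End CurveFlags.


(** * Complex conjugation *)

Section Conjugation.
Context (R : realType) (n : nat).
Local Notation conjm := (map_mx (@conjc R)).

Lemma conjmK p q : involutive (conjm : 'M[R[i]]_(p, q) -> 'M[R[i]]_(p, q)).
Proof. by move=> A; apply/matrixP => i j; rewrite !mxE conjcK. Qed.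

Lemma conjm_real p q (A : 'M[R]_(p, q)) :
  conjm (map_mx (real_complex R) A) = map_mx (real_complex R) A.
Proof. by apply/matrixP => i j; rewrite !mxE conjc_real. Qed.

Lemma conjm_unitmx (u : 'M[R[i]]_n) : (conjm u \in unitmx) = (u \in unitmx).
Proof. exact: (map_unitmx (@conjc R)). Qed.

Lemma conjm_vact j (u : 'M[R[i]]_n) (v : 'rV[R[i]]_n) : u \in unitmx ->
  (conjm v \in vact (stdv R[i] n j) (conjm u)) = (v \in vact (stdv R[i] n j) u).
Proof.
move=> uu; have cu : conjm u \in unitmx by rewrite conjm_unitmx.
rewrite (mem_vact _ _ cu) (mem_vact _ _ uu).
have -> : conjm v *m invmx (conjm u) = conjm (v *m invmx u).
  by rewrite -(map_invmx (@conjc R) u) -(map_mxM (@conjc R)).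
apply/idP/idP => /mem_stdv v0; apply/mem_stdv => l jl; have vl := v0 l jl.
  by move/eqP: vl; rewrite mxE conjc_eq0 => /eqP.
by rewrite mxE vl conjc0.
Qed.

(** Conjugation is semilinear, so it maps a basis of [V] to a free family. *)
Lemma leq_dim_conjm (V W : {vspace 'rV[R[i]]_n}) :
  (forall v, v \in V -> conjm v \in W) -> (\dim V <= \dim W)%N.
Proof.
move=> VW; pose X := [tuple of map conjm (vbasis V)].
have Xf : free X.
  apply/freeP => z z0 i; have /freeP Vf := basis_free (vbasisP V).
  suff : (z i)^*%C = 0 by move/eqP; rewrite conjc_eq0 => /eqP.
  apply: (Vf (fun i => (z i)^*%C)); apply: (can_inj (@conjmK 1 n)).
  rewrite map_mx0 -[RHS]z0 (raddf_sum conjm); apply: eq_bigr => j _.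
  by rewrite /= map_mxZ (nth_map 0) ?size_tuple//; congr (_ *: _); exact: conjcK.
rewrite -{1}(size_tuple (vbasis V)) -(size_map conjm) -(eqP Xf); apply: dimvS.
by apply/span_subvP => _ /mapP[v /vbasis_mem vV ->]; exact: VW.
Qed.

Lemma conjm_complexification (W : {vspace 'rV[R]_n}) v :
  v \in complexification W -> conjm v \in complexification W.
Proof.
move=> /coord_span ->; rewrite (raddf_sum conjm); apply: memv_suml => i _.
rewrite /= map_mxZ; apply: memvZ.
have iW : (i < size (vbasis W))%N by rewrite size_tuple; exact: ltn_ord.
rewrite (nth_map 0)// conjm_real; apply: memv_span; apply: map_f.
exact: mem_nth.
Qed.

(** [W] is the space of real vectors of [V]; the real and imaginary parts of a vector are
    combinations of it and its conjugate. *)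
Lemma real_subspace (V : {vspace 'rV[R[i]]_n}) :
  (forall v, v \in V -> conjm v \in V) ->
  exists W : {vspace 'rV[R]_n}, V = complexification W.
Proof.
move=> VV; have [|c w1 w2 V1 V2|W memW] := @ex_vspace _ _
  [set w : 'rV[R]_n | to_complex w \in V].
- by rewrite /= /to_complex map_mx0 mem0v.
- by rewrite /= /to_complex map_mxD map_mxZ memvD// memvZ.
exists W; apply/eqP; rewrite eqEsubv; apply/andP; split; last first.
  by apply/span_subvP => _ /mapP[w /vbasis_mem /memW wV ->].
have cW w : w \in W -> to_complex w \in complexification W.
  move=> /coord_vbasis ->; rewrite /to_complex (raddf_sum (map_mx (real_complex R))).
  apply: memv_suml => i _; rewrite /= map_mxZ; apply/memvZ/memv_span.
  by apply: map_f; rewrite mem_nth// size_tuple.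
apply/subvP => v vV.
have reE : to_complex (map_mx (@complex.Re R) v) = 2%:R^-1 *: (v + conjm v).
  by apply/rowP => l; rewrite !mxE ReJ_add mulrC.
have imE : to_complex (map_mx (@complex.Im R) v) = ('i / 2%:R) *: (conjm v - v).
  by apply/rowP => l; rewrite !mxE ImJ_sub -mulrA mulrC (mulrC _ 'i).
have -> : v = to_complex (map_mx (@complex.Re R) v) + 'i *: to_complex (map_mx (@complex.Im R) v).
  by apply/rowP => l; rewrite !mxE; exact: complexE.
have vcV := VV v vV.
by apply: memvD; [|apply: memvZ]; apply/cW/memW => /=;
  [rewrite reE | rewrite imE]; apply: memvZ; [apply: memvD | apply: memvB].
Qed.

End Conjugation.

Section RealFlags.
Context (R : realType) (n k : nat) (a : k.-tuple nat).
Local Notation conjm := (map_mx (@conjc R)).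

(** Recording a flag by a matrix allows entrywise limits and conjugates; different matrices may give
    the same flag. *)
Definition std_flag (u : 'M[R[i]]_n) : pflag R n k :=
  [ffun i => vact (stdv R[i] n (tnth a i)) u].

Lemma flag_act_std u g : flag_act (std_flag u) g = std_flag (u *m g).
Proof. by apply/ffunP => i; rewrite flag_actE !ffunE vactM. Qed.

Lemma std_flag_actK u g : g \in unitmx ->
  flag_act (std_flag g) (invmx g *m u) = std_flag u.
Proof. by move=> gu; rewrite flag_act_std mulmxA mulmxV// mul1mx. Qed.

Lemma flag_manifold_conj (u : 'M[R[i]]_n) : u \in unitmx ->
  flag_manifold a (std_flag u) -> flag_manifold a (std_flag (conjm u)).
Proof.
move=> uu [dE EE].
have an i : (tnth a i <= n)%N.
  by rewrite -(dE i) (leq_trans (dimvS (subvf _)))// dim_fullrV.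
have aa (i j : 'I_k) : (i <= j)%N -> (tnth a i <= tnth a j)%N.
  by move=> ij; rewrite -!dE dimvS// EE.
split=> [i|i j ij]; first by rewrite ffunE dim_vact ?conjm_unitmx// dim_stdv.
by rewrite !ffunE; apply/vactS/stdvS/aa.
Qed.

(** The frame [h] is real, so conjugation maps each [F j] to itself and preserves the rank
    conditions. *)
Lemma schubert_variety_conj (sigma : 'S_n) (F : nat -> {vspace 'rV[R[i]]_n})
    (h : 'M[R]_n) (u : 'M[R[i]]_n) : u \in unitmx -> h \in unitmx ->
  (forall j, (j <= n)%N -> F j = vact (stdv R[i] n j) (map_mx (real_complex R) h)) ->
  schubert_variety a sigma F (std_flag u) ->
  schubert_variety a sigma F (std_flag (conjm u)).
Proof.
move=> uu hu Fh [Efl EX]; split; first exact: flag_manifold_conj.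
move=> i j j1n; apply: leq_trans (EX i j j1n) _; apply: leq_dim_conjm => v.
have jn : (j <= n)%N by case/andP: j1n.
rewrite !ffunE !memv_cap conjm_vact// => /andP[-> /=].
have hCu : map_mx (real_complex R) h \in unitmx by rewrite (map_unitmx (real_complex R)).
by rewrite Fh// -[X in conjm v \in vact _ X]conjm_real (conjm_vact _ _ hCu).
Qed.

Lemma std_flag_conj (u : 'M[R[i]]_n) : u \in unitmx ->
  flag_manifold a (std_flag u) -> real_flag (std_flag u) ->
  std_flag (conjm u) = std_flag u.
Proof.
move=> uu [dE _] Er; apply/ffunP => i; apply/eqP; rewrite eqEdim.
rewrite !ffunE !dim_vact ?conjm_unitmx// leqnn andbT; apply/subvP => v.
rewrite -{1}[v]conjmK conjm_vact// => vE.
have [W WE] := Er i; move: vE; have : std_flag u i = complexification W by [].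
by rewrite ffunE => -> /conjm_complexification; rewrite conjmK.
Qed.

Lemma std_flag_real (u : 'M[R[i]]_n) : u \in unitmx ->
  std_flag (conjm u) = std_flag u -> real_flag (std_flag u).
Proof.
move=> uu uE i; apply: real_subspace => v; rewrite -{2}uE !ffunE => vE.
by rewrite conjm_vact.
Qed.

End RealFlags.

Section SchubertAction.
Context (R : realType) (n k : nat) (a : k.-tuple nat) (sigma : 'S_n).

Lemma schubert_variety_act (F F' : nat -> {vspace 'rV[R[i]]_n}) (q : 'M[R[i]]_n) :
  q \in unitmx -> (forall j, (j <= n)%N -> F' j = vact (F j) q) ->
  schubert_variety a sigma F =
  [set G : pflag R n k | schubert_variety a sigma F' (flag_act G q)].
Proof.
move=> qu F'E; apply/seteqP; split=> G /= [Gfl GX].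
  split; first exact: flag_manifold_act.
  move=> i j jn; apply: leq_trans (GX i j jn) _.
  by rewrite flag_actE F'E -?vact_cap ?dim_vact//; case/andP: jn.
have {}Gfl : flag_manifold a G.
  have := flag_manifold_act (g := invmx q) _ Gfl; rewrite unitmx_inv => /(_ qu).
  by rewrite -flag_actM mulmxV// flag_act1.
split=> // i j jn; apply: leq_trans (GX i j jn) _.
by rewrite flag_actE F'E -?vact_cap ?dim_vact//; case/andP: jn.
Qed.

Lemma leq_dim_stabilizer_act (E : pflag R n k) (p : 'M[R[i]]_n)
    (P Q : {vspace 'M[R[i]]_n}) : p \in unitmx ->
  (forall A, A \in P <-> stabilizer_algebra E A) ->
  (forall A, A \in Q <-> stabilizer_algebra (flag_act E p) A) ->
  (\dim P <= \dim Q)%N.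
Proof.
move=> pu PE QE.
pose L : 'End('M[R[i]]_n) := linfun (mulmx (invmx p) \o mulmxr p).
have LK A : p *m L A *m invmx p = A.
  by rewrite lfunE /= !mulmxA mulmxV// mul1mx mulmxK.
have Linj : (P :&: lker L)%VS = 0%VS.
  apply/eqP; rewrite -subv0; apply/subvP => A; rewrite memv_cap memv_ker.
  by case/andP => _ /eqP LA; rewrite -(LK A) LA mulmx0 mul0mx mem0v.
rewrite -(limg_dim_eq Linj); apply/dimvS/subvP => _ /memv_imgP[A /PE AE ->].
by apply/QE/(stabilizer_algebra_act _ _ pu); rewrite LK.
Qed.

End SchubertAction.


(** * Secant flags near osculating flags *)

Section SecantLimit.
Context (R : realType) (n k : nat) (a : k.-tuple nat) (gamma : R -> 'rV[R]_n)
  (m : nat) (sigma : 'I_m -> 'S_n) (g : 'M[R]_n) (t : 'I_m -> R).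
Hypotheses (aT : flag_type n a) (gu : g \in unitmx)
  (gammaE : forall t, gamma t = moment_curve n t *m g)
  (sigmaP : grassmannian_schubert_problem a sigma)
  (T0 : transverse_with_all_points_real a sigma
          (fun i => osculating_flag gamma (t i))).
Context (U : set_system nat) {UU : UltraFilter U}.
Hypothesis (Uoo : \oo `<=` U).
Let UF : ProperFilter U := ultra_proper.
Context (X : nat -> 'I_m -> nat -> seq R)
  (F : nat -> 'I_m -> nat -> {vspace 'rV[R[i]]_n}).
Hypotheses (sX : forall l i j, (j < n)%N -> size (X l i j) = j)
  (Xt : forall l i j x, (j < n)%N -> x \in X l i j -> `|x - t i| <= l.+1%:R^-1)
  (FX : forall l i j, (j <= n)%N -> F l i j =
     vact (stdv R[i] n j) (map_mx (real_complex R) (invmx (newton_mx n (X l i)) *m g))).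

Local Notation toC := (map_mx (real_complex R)).

Let F0 i := osculating_flag gamma (t i).
Let N l i := newton_mx n (X l i).
Let N0 i := newton_mx n (fun j => nseq j (t i)).
Let H i : 'M[R[i]]_n := toC (invmx (N0 i) *m g).
(** The inverse of the frame of the secant flag times that of the osculating flag: it carries the
    former flag to the latter. *)
Let q i l : 'M[R[i]]_n := toC (invmx g *m N l i) *m H i.

Let Nu l i : N l i \in unitmx.
Proof. by apply: newton_mx_unit => j; exact: sX. Qed.

Let N0u i : N0 i \in unitmx.
Proof. by apply: newton_mx_unit => j _; rewrite size_nseq. Qed.

Let Hu i : H i \in unitmx.
Proof. by rewrite (map_unitmx (real_complex R)) unitmx_mul unitmx_inv N0u. Qed.

Let qu i l : q i l \in unitmx.
Proof.
by rewrite unitmx_mul Hu (map_unitmx (real_complex R)) unitmx_mul unitmx_inv gu Nu.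
Qed.

Lemma newton_mx_limit i : mtends U (fun l => N l i) (N0 i).
Proof.
split=> r j; rewrite mxE; under eq_fun do rewrite mxE.
apply: tends_newton_poly => [l|x xX]; first exact: sX.
apply/cvgrPdist_lt => e e0; apply: Uoo.
have /cvgrPdist_lt/(_ e e0) : (fun l => l.+1%:R^-1 : R) @ \oo --> (0 : R).
  exact: cvg_harmonic.
apply: filterS => l; rewrite sub0r normrN gtr0_norm ?invr_gt0// distrC.
exact: le_lt_trans (Xt (ltn_ord j) (xX l)).
Qed.

Lemma displacement_limit i : mtends U (q i) 1%:M.
Proof.
have -> : 1%:M = toC (invmx g *m N0 i) *m H i.
  by rewrite -map_mxM mulmxA mulmxK// mulVmx// map_mx1.
apply: mtendsM; last exact: mtends_cst.
apply: mtends_real_complex; apply: mtendsM; first exact: mtends_cst.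
exact: newton_mx_limit.
Qed.

Lemma displacementE l i j : (j <= n)%N -> F0 i j = vact (F l i j) (q i l).
Proof.
move=> jn; rewrite FX// -vactM mulmxA -map_mxM mulmxA mulmxK// mulVmx//.
  by rewrite map_mx1 mul1mx /F0 (osculating_flagE gammaE).
exact: Nu.
Qed.

Lemma schubert_variety_displacement l i : schubert_variety a (sigma i) (F l i) =
  [set G : pflag R n k | schubert_variety a (sigma i) (F0 i) (flag_act G (q i l))].
Proof. by apply: schubert_variety_act => // j; exact: displacementE. Qed.

Lemma intersection_limit (E : nat -> pflag R n k) :
  (\forall l \near U, schubert_intersection a sigma (F l) (E l)) ->
  exists (u : nat -> 'M[R[i]]_n) (G : 'M[R[i]]_n),
    [/\ forall l, u l \in unitmx, G \in unitmx, mtends U u G,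
        \forall l \near U, E l = std_flag a (u l) &
        schubert_intersection a sigma F0 (std_flag a G)].
Proof.
move=> EF.
(* Outside the flag manifold the identity is a dummy value. *)
have /choice[u uE] l : exists u : 'M[R[i]]_n, u \is unitarymx /\
    (flag_manifold a (E l) -> E l = std_flag a u).
  have [Efl|nEfl] := pselect (flag_manifold a (E l)).
    have [u uu uE] := flag_unitary Efl; exists u; split=> // _.
    by apply/ffunP => i; rewrite ffunE.
  exists 1%:M; split=> //; apply/unitarymxP.
  by rewrite trmx1 map_mx1 mulmx1.
have uu l : u l \in unitmx by apply: unitarymx_unit; exact: (uE l).1.
have [G Gu uG] := unitarymx_ultra_limit (fun l => (uE l).1).
have Eu : \forall l \near U, E l = std_flag a (u l).
  by apply: filterS EF => l [Efl _]; exact: (uE l).2.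
exists u, G; split=> //.
have Gfl : flag_manifold a (std_flag a G).
  have [l [[Efl _] El]] := filter_ex (filterI EF Eu).
  have := flag_manifold_act (g := invmx (u l) *m G) _ Efl.
  rewrite El flag_act_std mulmxA mulmxV// mul1mx; apply.
  by rewrite unitmx_mul unitmx_inv uu.
(* This matrix tends to 1 and takes the limit flag to [E l] displaced by [q i l], which lies in the
   osculating Schubert variety. *)
split=> // i; apply: (@schubert_closed R U UF n k a _ _ _ (fun l => invmx G *m u l *m q i l)) => //.
  rewrite -[X in mtends _ _ X](mulmx1 1%:M); apply: mtendsM; last exact: displacement_limit.
  by rewrite -(mulVmx Gu); apply: mtendsM => //; exact: mtends_cst.
near=> l.
have El : E l = std_flag a (u l) by near: l.
have [_ /(_ i)] : schubert_intersection a sigma (F l) (E l) by near: l.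
rewrite schubert_variety_displacement /= El.
by rewrite (flag_actM _ (invmx G *m u l)) std_flag_actK.
Unshelve. all: by end_near. Qed.

Lemma intersection_displacement l E i : schubert_intersection a sigma (F l) E ->
  schubert_variety a (sigma i) (F0 i) (flag_act E (q i l)).
Proof. by move=> [_ /(_ i)]; rewrite schubert_variety_displacement. Qed.

Lemma intersection_unique (E : pflag R n k) (p p' : nat -> 'M[R[i]]_n) :
  schubert_intersection a sigma F0 E -> mtends U p 1%:M -> mtends U p' 1%:M ->
  (\forall l \near U, schubert_intersection a sigma (F l) (flag_act E (p l))) ->
  (\forall l \near U, schubert_intersection a sigma (F l) (flag_act E (p' l))) ->
  \forall l \near U, flag_act E (p l) = flag_act E (p' l).
Proof.
move=> E0 p1 p'1 pF p'F.
have [[_ /(_ E E0)[_ ET]] _] := T0.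
apply: (@transverse_unique R n k m U UF (fun i => schubert_variety a (sigma i) (F0 i))
  E ET q displacement_limit p p' p1 p'1).
- by apply: filterS pF => l pFl i; exact: intersection_displacement.
- by apply: filterS p'F => l p'Fl i; exact: intersection_displacement.
Qed.

Lemma intersection_real (E : nat -> pflag R n k) :
  (\forall l \near U, schubert_intersection a sigma (F l) (E l)) ->
  \forall l \near U, real_flag (E l).
Proof.
move=> EF; have [u [G [uu Gu uG Eu G0]]] := intersection_limit EF.
have Gr : std_flag a (map_mx (@conjc R) G) = std_flag a G.
  by apply: std_flag_conj => //; [exact: G0.1 | exact: T0.2].
have cGu : map_mx (@conjc R) G \in unitmx by rewrite conjm_unitmx.
pose p l := invmx G *m u l.
(* The matrices [G] and its conjugate may differ although their flags agree; the inverse of the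
   conjugate is what makes [p'] tend to 1. *)
pose p' l := invmx (map_mx (@conjc R) G) *m map_mx (@conjc R) (u l).
have p1 : mtends U p 1%:M.
  by rewrite -(mulVmx Gu); apply: mtendsM => //; exact: mtends_cst.
have p'1 : mtends U p' 1%:M.
  rewrite -(mulVmx cGu); apply: mtendsM; first exact: mtends_cst.
  exact: mtends_conjc.
have pE l : flag_act (std_flag a G) (p l) = std_flag a (u l).
  exact: std_flag_actK.
have p'E l : flag_act (std_flag a G) (p' l) = std_flag a (map_mx (@conjc R) (u l)).
  by rewrite -Gr; exact: std_flag_actK.
have uF : \forall l \near U, schubert_intersection a sigma (F l) (std_flag a (u l)).
  by apply: filterS (filterI EF Eu) => l [+ <-].
have cF : \forall l \near U,
    schubert_intersection a sigma (F l) (std_flag a (map_mx (@conjc R) (u l))).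
  apply: filterS uF => l [ufl uF].
  have cX i : schubert_variety a (sigma i) (F l i) (std_flag a (map_mx (@conjc R) (u l))).
    have hu : invmx (N l i) *m g \in unitmx by rewrite unitmx_mul unitmx_inv gu Nu.
    exact: (schubert_variety_conj (uu l) hu (fun j => @FX l i j) (uF i)).
  by split=> //; exact: flag_manifold_conj.
have uE : \forall l \near U,
    flag_act (std_flag a G) (p l) = flag_act (std_flag a G) (p' l).
  apply: intersection_unique => //.
    by apply: filterS uF => l; rewrite pE.
  by apply: filterS cF => l; rewrite p'E.
apply: filterS (filterI Eu uE) => l [-> ]; rewrite pE p'E => uc.
by apply: std_flag_real.
Qed.

Lemma leq_perm_length_dim i : (perm_length (sigma i) <= flag_dim n a)%N.
Proof. by rewrite -sigmaP.1.2 (bigD1 i)//= leq_addr. Qed.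

(** A squeeze: semicontinuity and smoothness at the limit bound the tangent dimension above, while
    [leq_dim_tangent] and [dim_stabilizer_algebra] bound it below by the same number. *)
Lemma intersection_smooth (E : nat -> pflag R n k) :
  (\forall l \near U, schubert_intersection a sigma (F l) (E l)) ->
  \forall l \near U, forall i, smooth_at (schubert_variety a (sigma i) (F l i))
    (flag_dim n a - perm_length (sigma i)) (E l).
Proof.
move=> EF; have [u [G [uu Gu uG Eu G0]]] := intersection_limit EF.
have [[_ /(_ _ G0)[Gsm _]] _] := T0.
pose p l := invmx G *m u l.
have p1 : mtends U p 1%:M.
  by rewrite -(mulVmx Gu); apply: mtendsM => //; exact: mtends_cst.
have pu l : p l \in unitmx by rewrite unitmx_mul unitmx_inv Gu uu.
have pE l : flag_act (std_flag a G) (p l) = std_flag a (u l).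
  exact: std_flag_actK.
apply: filter_forall => i.
have [S [P [ST SP dS]]] := Gsm i.
have pq1 : mtends U (fun l => p l *m q i l) 1%:M.
  rewrite -[X in mtends _ _ X](mulmx1 1%:M); apply: mtendsM => //.
  exact: displacement_limit.
have sc : \forall l \near U, p l \in unitmx -> q i l \in unitmx ->
    forall T' : {vspace 'M[R[i]]_n}, (forall A, A \in T' -> tangent_lift
      [set G0 | schubert_variety a (sigma i) (F0 i) (flag_act G0 (q i l))]
      (flag_act (std_flag a G) (p l)) A) -> (\dim T' <= \dim S)%N.
  exact: tangent_semicontinuity ST pq1.
near=> l.
have El : E l = flag_act (std_flag a G) (p l) by rewrite pE; near: l.
have [Efl EX] : schubert_intersection a sigma (F l) (E l) by near: l.
have [T TE] := tangent_lift_vspace (schubert_variety a (sigma i) (F l i)) (E l).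
have [Q QE] := stabilizer_algebra_vspace (E l).
exists T, Q; split=> //.
have TS : (\dim T <= \dim S)%N.
  have scl : p l \in unitmx -> q i l \in unitmx ->
      forall T' : {vspace 'M[R[i]]_n}, (forall A, A \in T' -> tangent_lift
        [set G0 | schubert_variety a (sigma i) (F0 i) (flag_act G0 (q i l))]
        (flag_act (std_flag a G) (p l)) A) -> (\dim T' <= \dim S)%N by near: l.
  by apply: scl => // A /TE; rewrite schubert_variety_displacement El.
have PQ : (\dim P <= \dim Q)%N.
  by apply: (leq_dim_stabilizer_act (pu l) SP); rewrite -El.
have Qd := dim_stabilizer_algebra aT Efl QE.
have [c ac] : exists c, tnth a c = delta (sigma i).
  have /tnthP[c ->] : delta (sigma i) \in a; last by exists c.
  by apply: (sigmaP.1.1 i); rewrite (grassmannian_descents (sigmaP.2 i)) mem_head.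
have Tl : (n * n <= \dim T + perm_length (sigma i))%N.
  apply: (leq_dim_tangent (sigmaP.2 i) ac _ _ (EX i) TE); last exact: FX.
  by rewrite (map_unitmx (real_complex R)) unitmx_mul unitmx_inv gu Nu.
by have := leq_perm_length_dim i; lia.
Unshelve. all: by end_near. Qed.

Lemma intersection_tangent (E : nat -> pflag R n k) :
  (\forall l \near U, schubert_intersection a sigma (F l) (E l)) ->
  \forall l \near U, forall A,
    (forall i, tangent_lift (schubert_variety a (sigma i) (F l i)) (E l) A) ->
    stabilizer_algebra (E l) A.
Proof.
move=> EF; have [u [G [uu Gu uG Eu G0]]] := intersection_limit EF.
have [[_ /(_ _ G0)[_ GT]] _] := T0.
pose p l := invmx G *m u l.
have p1 : mtends U p 1%:M.
  by rewrite -(mulVmx Gu); apply: mtendsM => //; exact: mtends_cst.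
have pE l : flag_act (std_flag a G) (p l) = std_flag a (u l).
  exact: std_flag_actK.
have Ep : \forall l \near U, E l = flag_act (std_flag a G) (p l).
  by apply: filterS Eu => l; rewrite pE.
have := @transverse_stable R n k m U UF (fun i => schubert_variety a (sigma i) (F0 i))
  _ GT q displacement_limit p p1.
have pF : \forall l \near U, forall i,
    schubert_variety a (sigma i) (F0 i) (flag_act (flag_act (std_flag a G) (p l)) (q i l)).
  by apply: filterS (filterI EF Ep) => l [lF <-] i; exact: intersection_displacement.
move=> /(_ pF) st; apply: filterS (filterI Ep st) => l [-> stl] A TA.
by apply: stl => i; rewrite -schubert_variety_displacement.
Qed.

(** Otherwise almost every intersection contains a sequence of distinct points [E l r]. Their limits
    in [l] lie in a finite set, so two indices [r] and [s] share a limit, and uniqueness near it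
    forces [E l r = E l s]. *)
Lemma intersection_finite : \forall l \near U, finite_set (schubert_intersection a sigma (F l)).
Proof.
have [//|Uinf] := in_ultra_setVsetC
  [set l | finite_set (schubert_intersection a sigma (F l))] UU.
have /choice[E EP] l : exists E : nat -> pflag R n k,
    ~ finite_set (schubert_intersection a sigma (F l)) ->
    injective E /\ forall r, schubert_intersection a sigma (F l) (E r).
  have [fin|/infiniteP/card_leP/unsquash f] :=
      pselect (finite_set (schubert_intersection a sigma (F l))).
    by exists (fun=> [ffun=> 0%VS]) => /(_ fin).
  exists (fun r => val (f (to_setT r))) => _; split=> [r s /val_inj|r].
    by move=> /(@inj _ _ setT f); rewrite !inE => /(_ I I) /(congr1 val).
  exact: set_mem (valP (f (to_setT r))).
have EF r : \forall l \near U, schubert_intersection a sigma (F l) (E l r).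
  by apply: filterS Uinf => l /EP[_]; exact.
have /choice[u /choice[G uG]] r := intersection_limit (EF r).
have [r [s [rs rsE]]] : exists r s, r <> s /\ std_flag (R := R) a (G r) = std_flag a (G s).
  apply: contrapT => nE.
  have Ginj : {in [set: nat] &, injective (fun r => std_flag (R := R) a (G r))}.
    by move=> r s _ _ rsE; apply: contrapT => rs; apply: nE; exists r, s.
  apply: infinite_nat; rewrite -(eq_finite_set (inj_card_eq Ginj)).
  apply: sub_finite_set T0.1.1 => _ [r _ <-].
  by have [] := uG r.
pose p r l := invmx (G r) *m u r l.
have p1 r' : mtends U (p r') 1%:M.
  have [_ Gu ur _ _] := uG r'.
  by rewrite -(mulVmx Gu); apply: mtendsM => //; exact: mtends_cst.
have pE r' l : flag_act (std_flag a (G r')) (p r' l) = std_flag a (u r' l).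
  by have [_ Gu _ _ _] := uG r'; exact: std_flag_actK.
have uF r' : \forall l \near U, schubert_intersection a sigma (F l) (std_flag a (u r' l)).
  by have [_ _ _ Er _] := uG r'; apply: filterS (filterI (EF r') Er) => l [+ <-].
have : \forall l \near U, flag_act (std_flag a (G r)) (p r l) =
                          flag_act (std_flag a (G r)) (p s l).
  apply: intersection_unique => //; first by have [] := uG r.
    by apply: filterS (uF r) => l; rewrite pE.
  by apply: filterS (uF s) => l; rewrite rsE pE.
have [_ _ _ Er _] := uG r; have [_ _ _ Es _] := uG s.
move=> rsu; have [l [[infl Erl] [Esl rsul]]] :=
  filter_ex (filterI (filterI Uinf Er) (filterI Es rsu)).
case: rs; apply: (EP l infl).1; rewrite Erl Esl.
by move: rsul; rewrite pE rsE pE.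
Qed.

(** If almost every [l] had a bad point, a choice of such points would contradict the preceding
    lemmas. *)
Lemma secant_limit_transverse :
  \forall l \near U, transverse_with_all_points_real a sigma (F l).
Proof.
pose good l E := [/\ forall i, smooth_at (schubert_variety a (sigma i) (F l i))
    (flag_dim n a - perm_length (sigma i)) E,
  forall A, (forall i, tangent_lift (schubert_variety a (sigma i) (F l i)) E A) ->
    stabilizer_algebra E A & real_flag E].
have [allgood|] := in_ultra_setVsetC
    [set l | forall E, schubert_intersection a sigma (F l) E -> good l E] UU.
  apply: filterS (filterI intersection_finite allgood) => l [fin gl].
  by split; [split=> // E /gl[] | move=> E /gl[]].
move=> bad.
have /choice[E EP] l : exists E : pflag R n k,
    ~ (forall E, schubert_intersection a sigma (F l) E -> good l E) ->
    schubert_intersection a sigma (F l) E /\ ~ good l E.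
  have [gl|/existsNP[E /not_implyP EP]] :=
    pselect (forall E, schubert_intersection a sigma (F l) E -> good l E).
    by exists [ffun=> 0%VS] => /(_ gl).
  by exists E.
have EF : \forall l \near U, schubert_intersection a sigma (F l) (E l).
  by apply: filterS bad => l /EP[].
have [l [badl [sml [tal rel]]]] := filter_ex (filterI bad
  (filterI (intersection_smooth EF) (filterI (intersection_tangent EF) (intersection_real EF)))).
by have [_ []] := EP l badl.
Qed.

End SecantLimit.

Lemma interval_of_length_dist (R : realType) (eps : R) (I : interval R) x y :
  interval_of_length eps I -> x \in I -> y \in I -> `|x - y| <= eps.
Proof.
move=> [u [b1 [b2 ->]]]; rewrite !in_itv /= => /andP[/lteifW ux /lteifW xu].
by move=> /andP[/lteifW uy /lteifW yu]; rewrite ler_norml; lra.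
Qed.

Theorem theorem4p2 (R : realType) (n k : nat) (a : k.-tuple nat)
    (gamma : R -> 'rV[R]_n) (m : nat) (sigma : 'I_m -> 'S_n) :
  (0 < n)%N ->
  flag_type n a ->
  rational_normal_curve gamma ->
  grassmannian_schubert_problem a sigma ->
  monotone_conjecture a gamma sigma ->
  forall t : 'I_m -> R, injective t -> monotone_points sigma t ->
  exists2 eps : R, 0 < eps &
    forall F : 'I_m -> nat -> {vspace 'rV[R[i]]_n},
      (forall i : 'I_m, exists I : interval R,
         [/\ interval_of_length eps I, t i \in I & secant_flag gamma I (F i)]) ->
      transverse_with_all_points_real a sigma F.
Proof.
move=> n0 aT [g gu gammaE] sigmaP conj t tinj tmon.
have T0 := conj t tinj tmon.
apply: contrapT => noeps.
have /choice[F FP] (l : nat) : exists F : 'I_m -> nat -> {vspace 'rV[R[i]]_n},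
    (forall i : 'I_m, exists I : interval R,
       [/\ interval_of_length l.+1%:R^-1 I, t i \in I & secant_flag gamma I (F i)]) /\
    ~ transverse_with_all_points_real a sigma F.
  apply: contrapT => noF; apply: noeps; exists l.+1%:R^-1; first by rewrite invr_gt0.
  move=> F FI; apply: contrapT => FT; apply: noF; by exists F.
have /choice[X XP] (l : nat) : exists X : 'I_m -> nat -> seq R, forall i,
    [/\ forall j, (j < n)%N -> size (X i j) = j,
        forall j x, (j < n)%N -> x \in X i j -> `|x - t i| <= l.+1%:R^-1 &
        forall j, (j <= n)%N -> F l i j = vact (stdv R[i] n j)
          (map_mx (real_complex R) (invmx (newton_mx n (X i)) *m g))].
  suff /fin_all_exists : forall i, exists X : nat -> seq R,
    [/\ forall j, (j < n)%N -> size (X j) = j,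
        forall j x, (j < n)%N -> x \in X j -> `|x - t i| <= l.+1%:R^-1 &
        forall j, (j <= n)%N -> F l i j = vact (stdv R[i] n j)
          (map_mx (real_complex R) (invmx (newton_mx n X) *m g))] by [].
  move=> i; have [I [Il tI FI]] := (FP l).1 i.
  have [X [sX XI FX]] := secant_flag_newton gu gammaE n0 FI.
  exists X; split=> // j x jn xX; apply: interval_of_length_dist Il _ tI.
  exact: XI xX.
(* Refining the filter at infinity ensures that the interval lengths tend to 0 along [U]; a single
   good [l] then gives the contradiction. *)
have [U [UU Uoo]] := ultraFilterLemma eventually_filter.
have [l Fl] := filter_ex (@secant_limit_transverse R n k a gamma m sigma g t aT gu gammaE
  sigmaP T0 U UU Uoo X F
  (fun l i j => let: And3 sX _ _ := XP l i in sX j)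
  (fun l i j x => let: And3 _ Xt _ := XP l i in Xt j x)
  (fun l i j => let: And3 _ _ FX := XP l i in FX j)).
exact: (FP l).2.
Qed.
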